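(* Let $p$ be an odd prime, $0<\nu\le\eta\le2\nu$, $1\le r\le\nu$, $I:=\mathbb{Z}/p^{r}\mathbb{Z}\oplus\mathbb{Z}/p^{r}\mathbb{Z}$ (column vectors). Let $a,b\in\mathbb{Z}/p^{r}\mathbb{Z}$, let $A:=\begin{pmatrix}1&a\\0&1\end{pmatrix}$ and $B:=\begin{pmatrix}0&b\\0&0\end{pmatrix}$ in $\operatorname{End}(I)$, and let $h\diamond y:=A^{h}y$ and $y\prec h:=hBy$ for $h\in H$, $y\in I$. Assume that $a$, $b$ and $c:=a+b$ are non-zero and write $a=a_1p^{a_2}$, $b=b_1p^{b_2}$ and $c=c_1p^{c_2}$, where $p\nmid a_1$, $p\nmid b_1$ and $p\nmid c_1$. Set $t:=\min\{a_2,b_2\}$. Then $$\operatorname{H}^2_{\diamond,\prec}(H,I)\simeq\left(\frac{\mathbb{Z}/p^{r}\mathbb{Z}}{p^{c_2}(\mathbb{Z}/p^{r}\mathbb{Z})}\oplus\mathbb{Z}/p^{r}\mathbb{Z}\right)\oplus\left(\mathbb{Z}/p^{r}\mathbb{Z}\oplus p^{r-t}(\mathbb{Z}/p^{r}\mathbb{Z})\right),$$ and a complete family $(\alpha_1(\gamma),f_{f_0,\gamma})$ of representatives of 2-cocycles modulo coboundaries is parametrized by the pairs $$(f_0,\gamma)\in\left\{\left(\binom{z_1}{z_2},\binom{z_3}{p^{r-t}z_4}\right):0\le z_1<p^{c_2},\ 0\le z_2,z_3<p^{r}\text{ and }0\le z_4<p^{t}\right\}.$$ (Here $\binom{z_1}{z_2}$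 and $\binom{z_3}{p^{r-t}z_4}$ denote column vectors in $I$.)
   Context: $H=\mathbb{Z}/p^{\eta}\mathbb{Z}$ with its usual sum, the linear cycle set operation $i\cdot j:=(1-p^{\nu}i)j$, and the operation $i\times j:=i+j+p^{\nu}ij$, for which $H$ is a cyclic group generated by $1$, with powers $1^{\times k}=k+\binom{k}{2}p^{\nu}$. With the data of the claim, $A^{p^{\nu}}=\operatorname{Id}$, $p^{\nu}I=0$, and $1^{\times k}\diamond y=A^{k}y$. A 2-cocycle is a pair $(\beta,f)$ of maps $H\times H\to I$, both vanishing when some argument is $0$, with $\beta$ symmetric, such that for all $x,y,z\in H$: $\beta(y,z)-\beta(x+y,z)+\beta(x,y+z)-\beta(x,y)=0$; $f(x,y+z)-f(x,y)-f(x,z)=x\diamond\beta(y,z)-\beta(x\cdot y,x\cdot z)$; $f(x+y,z)=(x\cdot y)\diamond f(x,z)+f(x\cdot y,x\cdot z)+\bigl((x\cdot y)\diamond f(x,y)\bigr)\prec\bigl((x+y)\cdot z\bigr)+\bigl((x+y)\diamond\beta(x,y)\bigr)\prec\bigl((x+y)\cdot z\bigr)$. It is a coboundary if there is $\tau\colon H\to I$ with $\tau(0)=0$ such that $\beta(x,y)=\tau(x)-\tau(x+y)+\tau(y)$ and $f(x,y)=\tau(x\cdot y)-x\diamond\tau(y)-(x\diamond\tau(x))\prec(x\cdot y)$. $\operatorname{H}^2_{\diamond,\prec}(H,I)$ is the group of 2-cocycles modulo coboundaries. For $\gamma\in I$ and integers $0\le i,j<p^{\eta}$: $\alpha_1(\gamma)(i,j):=\gamma$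 if $i+j\ge p^{\eta}$, and $0$ otherwise (a map $H\times H\to I$). For $f_0,\gamma\in I$ with $p^{\eta}f_0=(p^{\eta}-p^{\nu}+1)\gamma-A\gamma$, put $\Gamma(\gamma,h):=A\alpha_1(\gamma)(h,1)-\alpha_1(\gamma)(1\cdot h,1\cdot1)$; the map $\hat f(n):=nf_0+\sum_{h=0}^{n-1}\Gamma(\gamma,h)$ ($n\in\mathbb{N}_0$) is $p^{\eta}$-periodic and induces $\tilde f\colon H\to I$. Put $b_l^{*}:=l+\binom{l+1}{2}p^{\nu}\in H$ (binomial coefficient) and define $$f_{f_0,\gamma}(1^{\times m},x):=\sum_{j=0}^{m-1}A^{m-1-j}\tilde f(j\cdot x)+(m\cdot x)B\sum_{l=0}^{m-1}A^{l}\tilde f(b_l^{*})\qquad(0\le m<p^{\eta},\ x\in H).$$ A set $\Lambda\subseteq I\times I$ parametrizes a complete family of representatives of 2-cocycles modulo coboundaries if $(\alpha_1(\gamma),f_{f_0,\gamma})$ is a 2-cocycle for every $(f_0,\gamma)\in\Lambda$ and each class in $\operatorname{H}^2_{\diamond,\prec}(H,I)$ contains $(\alpha_1(\gamma),f_{f_0,\gamma})$ for exactly one $(f_0,\gamma)\in\Lambda$. *)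

(* Defs.v *)
From HB Require Import structures.
From mathcomp Require Import all_boot all_order all_algebra all_fingroup all_solvable.
From mathcomp Require Import zify.

Set Implicit Arguments.
Unset Strict Implicit.
Unset Printing Implicit Defensive.

Import GRing.Theory.
Local Open Scope ring_scope.

Definition colvec2 (R : nmodType) (x y : R) : 'cV[R]_2 := \col_i [:: x; y]`_i.

Definition mx2 (R : nmodType) (x y z t : R) : 'M[R]_2 :=
  \matrix_(i, j) (nth [::] [:: [:: x; y]; [:: z; t]] i)`_j.

(* The subgroup d(Z/qZ) of the additive group Z/qZ. *)
Definition multZ (q d : nat) : {set 'Z_q} := [set x *+ d | x in [set: 'Z_q]].

Lemma multZ_group_set q d : group_set (multZ q d).
Proof.
apply/group_setP; split=> [|_ _ /imsetP[x _ ->] /imsetP[y _ ->]].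
  by apply/imsetP; exists 0; rewrite ?inE // mul0rn.
by apply/imsetP; exists (x + y); rewrite ?inE // mulrnDl.
Qed.
Canonical multZ_group q d := Group (multZ_group_set q d).

(* Pointwise addition makes {ffun aT -> rT} a finite group. *)
HB.instance Definition _ (aT : finType) (rT : finZmodType) :=
  [finGroupMixin of {ffun aT -> rT} for +%R].

Section LinearCycleSet.
Context (p nu eta : nat).
Local Notation H := 'Z_(p ^ eta).

Definition ldot (i j : H) : H := (1 - (p ^ nu)%:R * i) * j.

Definition ltimes (i j : H) : H := i + j + (p ^ nu)%:R * i * j.

(* 1^{x k}, the k-th power of 1 for ltimes, whose neutral element is 0. *)
Definition ltimesX (k : nat) : H := iter k (ltimes 1) 0.

(* The m < p^eta such that h = 1^{x m}; see ltimesXK and ltimesX_log. *)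
Definition ltimes_log (h : H) : nat :=
  index h [seq ltimesX k | k <- iota 0 (p ^ eta)].

Hypotheses (p_pr : prime p) (p_odd : odd p) (nu_gt0 : (0 < nu)%N).
Hypotheses (le_nu_eta : (nu <= eta)%N) (le_eta_2nu : (eta <= 2 * nu)%N).

Let gt1 : (1 < p ^ eta)%N.
Proof. by rewrite -{1}(expn0 p) ltn_exp2l ?prime_gt1 //; lia. Qed.

Lemma ltimesXE k : ltimesX k = (k + 'C(k, 2) * p ^ nu)%:R.
Proof.
elim: k => [|k IHk] //; rewrite /ltimesX iterS -/(ltimesX k) IHk /ltimes mulr1.
rewrite -natrM -[1]/(1%:R) -!natrD; apply/val_inj; rewrite /= !val_Zp_nat //.
have -> : (p ^ nu * (k + 'C(k, 2) * p ^ nu) =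
           p ^ nu * k + 'C(k, 2) * p ^ (2 * nu - eta) * p ^ eta)%N.
  rewrite mulnDr mulnCA -expnD addnn -mul2n -mulnA -expnD.
  by rewrite [(_ - _ + _)%N]subnK.
by rewrite binS bin1 addnA addnC modnMDl; congr (_ %% _)%N; lia.
Qed.

Lemma ltimesX_inj m n :
  (m < p ^ eta)%N -> (n < p ^ eta)%N -> ltimesX m = ltimesX n -> m = n.
Proof.
wlog le_mn : m n / (m <= n)%N => [IH|] lt_m lt_n eq_mn.
  by case/orP: (leq_total m n) => /IH; [exact | move/(_ lt_n lt_m (esym eq_mn))].
move: eq_mn; rewrite !ltimesXE => /(congr1 val); rewrite /= !val_Zp_nat // => e.
have le_bin : ('C(m, 2) <= 'C(n, 2))%N by apply: leq_bin2l.
have /eqP := esym e; rewrite eqn_mod_dvd; last first.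
  by apply: leq_add => //; apply: leq_mul.
move/(dvdn_mull 2).
have bin2E k : (2 * 'C(k, 2) = k * k.-1)%N by rewrite -mul_bin_diag bin1.
have -> : (2 * (n + 'C(n, 2) * p ^ nu - (m + 'C(m, 2) * p ^ nu)) =
           (n - m) * (2 + (n + m).-1 * p ^ nu))%N.
  rewrite mulnBr !mulnDr !mulnA !bin2E [in RHS]mulnC.
  case: n m le_mn {lt_m lt_n e le_bin} => [|n] [|m] //= le_mn; first by lia.
  have [k ->] : exists k, n = (m + k)%N by exists (n - m)%N; lia.
  by move: (p ^ nu)%N => P; nia.
rewrite Gauss_dvdl; last first.
  apply: coprimeXl; rewrite prime_coprime // -(prednK nu_gt0) expnS mulnCA.
  by rewrite dvdn_addl ?dvdn_mulr // (dvdn_prime2 p_pr) //; apply: contraTneq p_odd => ->.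
by move/dvdn_leq; lia.
Qed.

Lemma ltimesXK m : (m < p ^ eta)%N -> ltimes_log (ltimesX m) = m.
Proof.
move=> lt_m; rewrite /ltimes_log.
have u : uniq [seq ltimesX k | k <- iota 0 (p ^ eta)].
  rewrite map_inj_in_uniq ?iota_uniq // => i j.
  by rewrite !mem_iota /= !add0n; apply: ltimesX_inj.
have {1}-> : ltimesX m = nth 0 [seq ltimesX k | k <- iota 0 (p ^ eta)] m.
  by rewrite (nth_map 0%N) ?size_iota // nth_iota.
by rewrite index_uniq // size_map size_iota.
Qed.

Lemma ltimesX_log h : (ltimes_log h < p ^ eta)%N /\ ltimesX (ltimes_log h) = h.
Proof.
have ltH (m : H) : (m < p ^ eta)%N by rewrite -{2}(Zp_cast gt1).
have inj : injective (fun m : H => ltimesX m).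
  by move=> m n /(ltimesX_inj (ltH m) (ltH n)) /val_inj.
by have [g _ gK] := injF_bij inj; rewrite -[h]gK ltimesXK.
Qed.

End LinearCycleSet.

Section Cohomology.
Context (p nu eta r : nat) (A B : 'M['Z_(p ^ r)]_2).
Local Notation H := 'Z_(p ^ eta).
Local Notation I := 'cV['Z_(p ^ r)]_2.
Local Notation "x ⋅ y" := (@ldot p nu eta x y) (at level 39).

Definition diamond (h : H) (y : I) : I := A ^+ h *m y.
Definition prec (y : I) (h : H) : I := (B *m y) *+ h.
Local Notation "h ⋄ y" := (diamond h y) (at level 38, right associativity).
Local Notation "y ≺ h" := (prec y h) (at level 45).

Definition cochain : finGroupType :=
  ({ffun H * H -> I} * {ffun H * H -> I})%type.

Definition is_cocycle (c : cochain) : bool :=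
  let beta x y := c.1 (x, y) in let f x y := c.2 (x, y) in
  [&& [forall x, (beta x 0 == 0) && (beta 0 x == 0)],
      [forall x, (f x 0 == 0) && (f 0 x == 0)],
      [forall x, forall y, beta x y == beta y x]
    & [forall x, forall y, forall z,
      [&& beta y z - beta (x + y) z + beta x (y + z) - beta x y == 0,
          f x (y + z) - f x y - f x z
            == x ⋄ beta y z - beta (x ⋅ y) (x ⋅ z)
        & f (x + y) z
            == (x ⋅ y) ⋄ f x z + f (x ⋅ y) (x ⋅ z)
               + (((x ⋅ y) ⋄ f x y) ≺ ((x + y) ⋅ z))
               + (((x + y) ⋄ beta x y) ≺ ((x + y) ⋅ z))]]].

Definition is_cobounded (c : cochain) : bool :=
  [exists tau : {ffun H -> I},
    [&& tau 0 == 0,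
        [forall x, forall y, c.1 (x, y) == tau x - tau (x + y) + tau y]
      & [forall x, forall y, c.2 (x, y)
          == tau (x ⋅ y) - x ⋄ tau y - ((x ⋄ tau x) ≺ (x ⋅ y))]]].

Definition cocycles : {set cochain} := [set c | is_cocycle c].

Definition coboundaries : {set cochain} := [set c in cocycles | is_cobounded c].

Let diamondD h : {morph diamond h : y z / y + z}.
Proof. by move=> y z; rewrite /diamond mulmxDr. Qed.

Let precD h : {morph prec ^~ h : y z / y + z}.
Proof. by move=> y z; rewrite /prec mulmxDr mulrnDl. Qed.

Let diamond0 h : diamond h 0 = 0.
Proof. by rewrite /diamond mulmx0. Qed.

Let prec0 h : prec 0 h = 0.
Proof. by rewrite /prec mulmx0 mul0rn. Qed.

Let one1E x : (1%g : cochain).1 x = 0.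
Proof. exact: (ffunE (fun=> 0)). Qed.

Let one2E x : (1%g : cochain).2 x = 0.
Proof. exact: (ffunE (fun=> 0)). Qed.

Let mul1E (c d : cochain) x : (c * d)%g.1 x = c.1 x + d.1 x.
Proof. by rewrite ffunE. Qed.

Let mul2E (c d : cochain) x : (c * d)%g.2 x = c.2 x + d.2 x.
Proof. by rewrite ffunE. Qed.

Let linE := (ffunE, diamondD, precD, opprD).

Local Ltac add_eqs := repeat (rewrite [RHS]addrACA; congr (_ + _)).

Lemma cocycles_group_set : group_set cocycles.
Proof.
apply/group_setP; split=> [|c d]; rewrite !inE.
  apply/and4P; split; do ?[apply/forallP => ?];
    by rewrite !(one1E, one2E, diamond0, prec0, subr0, addr0) eqxx.
move=> /and4P[/forallP c1 /forallP c2 /forallP c3 /forallP c4].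
move=> /and4P[/forallP d1 /forallP d2 /forallP d3 /forallP d4].
apply/and4P; split; apply/forallP=> x; last 2 first.
- by apply/forallP=> y; rewrite !mul1E (eqP (forallP (c3 x) y)) (eqP (forallP (d3 x) y)).
- apply/forallP=> y; apply/forallP=> z; rewrite !mul1E !mul2E !linE.
  have /and3P[/eqP c5 /eqP c6 /eqP c7] := forallP (forallP (c4 x) y) z.
  have /and3P[/eqP d5 /eqP d6 /eqP d7] := forallP (forallP (d4 x) y) z.
  apply/and3P; split; apply/eqP.
  + by rewrite -[RHS]addr0 -{1}c5 -d5; add_eqs.
  + transitivity ((c.2 (x, y + z) - c.2 (x, y) - c.2 (x, z)) +
                  (d.2 (x, y + z) - d.2 (x, y) - d.2 (x, z))); first by add_eqs.
    by rewrite c6 d6 addrACA.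
  + by rewrite c7 d7; apply/esym; add_eqs.
- by have /andP[/eqP e1 /eqP e2] := c1 x; have /andP[/eqP e3 /eqP e4] := d1 x;
    rewrite !mul1E e1 e2 e3 e4 addr0 eqxx.
- by have /andP[/eqP e1 /eqP e2] := c2 x; have /andP[/eqP e3 /eqP e4] := d2 x;
    rewrite !mul2E e1 e2 e3 e4 addr0 eqxx.
Qed.
Canonical cocycles_group := Group cocycles_group_set.

Lemma coboundaries_group_set : group_set coboundaries.
Proof.
apply/group_setP; split=> [|c d]; rewrite !(inE, in_setI).
  have /= := group1 cocycles_group; rewrite inE => ->.
  apply/existsP; exists 0; apply/and3P; split; do ?[apply/forallP => ?];
    by rewrite !(one1E, one2E, ffunE, diamond0, prec0, subr0, addr0).
case/andP=> Zc /existsP[s /and3P[/eqP s0 /forallP s1 /forallP s2]].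
case/andP=> Zd /existsP[t /and3P[/eqP t0 /forallP t1 /forallP t2]].
apply/andP; split.
  by have /= := @groupM _ cocycles_group c d; rewrite !inE; apply.
apply/existsP; exists (s + t); rewrite ffunE s0 t0 addr0 eqxx /=.
apply/andP; split; apply/forallP=> x; apply/forallP=> y; apply/eqP.
- rewrite mul1E (eqP (forallP (s1 x) y)) (eqP (forallP (t1 x) y)) !linE.
  by apply/esym; add_eqs.
- rewrite mul2E (eqP (forallP (s2 x) y)) (eqP (forallP (t2 x) y)) !linE.
  by apply/esym; add_eqs.
Qed.
Canonical coboundaries_group := Group coboundaries_group_set.

Definition cohomology2 : {set coset_of coboundaries} := (cocycles / coboundaries)%g.

Definition alpha1 (gamma : I) : {ffun H * H -> I} :=
  [ffun ij : H * H => if (p ^ eta <= ij.1 + ij.2)%N then gamma else 0].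

Definition admissible (f0 gamma : I) : Prop :=
  f0 *+ p ^ eta = gamma *+ (p ^ eta - p ^ nu + 1) - A *m gamma.

Definition Gamma (gamma : I) (h : H) : I :=
  A *m alpha1 gamma (h, 1) - alpha1 gamma (1 ⋅ h, 1 ⋅ 1).

Definition fhat (f0 gamma : I) (n : nat) : I :=
  f0 *+ n + \sum_(h < n) Gamma gamma h%:R.

(* fhat is p^eta-periodic when (f0, gamma) is admissible; the induced map is
   read off on the representatives 0 <= h < p^eta. *)
Definition ftilde (f0 gamma : I) (h : H) : I := fhat f0 gamma h.

Definition bstar (l : nat) : H := (l + 'C(l.+1, 2) * p ^ nu)%:R.

(* The value at (1^{x m}, x), for 0 <= m < p^eta. *)
Definition frepX (f0 gamma : I) (m : nat) (x : H) : I :=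
  \sum_(j < m) A ^+ (m - 1 - j) *m ftilde f0 gamma (j%:R ⋅ x)
  + prec (\sum_(l < m) A ^+ l *m ftilde f0 gamma (bstar l)) (m%:R ⋅ x).

Definition frep (f0 gamma : I) : {ffun H * H -> I} :=
  [ffun hx : H * H => frepX f0 gamma (ltimes_log nu hx.1) hx.2].

Definition rep_cocycle (q : I * I) : cochain := (alpha1 q.2, frep q.1 q.2).

(* Admissibility is required because frep is only meaningful under it. *)
Definition parametrizes_cohomology2 (Lambda : I * I -> Prop) : Prop :=
  [/\ forall q, Lambda q -> admissible q.1 q.2,
      forall q, Lambda q -> rep_cocycle q \in cocycles
    & forall X : coset_of coboundaries, X \in cohomology2 ->
        exists! q, Lambda q /\ rep_cocycle q \in (X : {set cochain})].

End Cohomology.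

(* Main.v *)
From HB Require Import structures.
Require Import Defs.
From mathcomp Require Import all_boot all_order all_algebra all_fingroup all_solvable.
From mathcomp Require Import ring zify.
Import GRing.Theory.
Local Open Scope ring_scope.

Set Implicit Arguments.
Unset Strict Implicit.
Unset Printing Implicit Defensive.

(* Write R = Z/p^r.  Attach to a cochain (beta, f) the invariants
     gamma = sum_y beta(y,1)   and   f0 = f(1,1) + sum_{0 <= i < 1.1} beta(i,1),
   where 1.1 = 1 - p^nu is read off in [0, p^eta); both are additive.  Summing the
   cocycle identities over H shows that a cocycle has A gamma = gamma and
   B gamma = 0: the sums over H collapse because p^nu kills I, and
   y |-> sum_x f(x,y) is additive, hence vanishes at p^nu.  Subtracting the
   coboundary of tau(k) = - sum_{i<k} beta(i,1) turns beta into alpha_1(gamma) and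
   f(1,1) into f0, and then the identities determine f recursively, giving
   f_{f0,gamma}.  That every (f0, gamma) with A gamma = gamma and B gamma = 0
   occurs is seen from an explicit cocycle (a bilinear one plus a "carry" one,
   see [carry_f]), which by uniqueness has to be the representative.  Finally
   the coboundaries are the cocycles with gamma = 0 and f0 in (a+b)R + 0. *)

(** * Cocycles in coordinates over abstract rings *)

(* H, R and q stand for Z/p^eta, Z/p^r and p^nu. The coordinates of beta and f are
   b0, b1 and f0, f1; the operators A and B are spelled out in terms of a and b. *)
Section ScalarCocycles.
Context (H : finComNzRingType) (R : comNzRingType) (q : nat) (rd : {rmorphism H -> R}).
Context (a b : R).
Local Notation P := (q%:R : H).
Hypotheses (PP : P * P = 0) (qR : q%:R = 0 :> R).
Implicit Types (x y z : H) (t s : H -> R).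

(** The cycle set operation over an abstract ring; it is convertible with [ldot] when H = Z/p^eta
    and q = p^nu. *)
Definition dot x y : H := (1 - P * x) * y.

(** The cocycle identities in coordinates: A^h has rows (1, ha) and (0, 1), B A^h = B, and B sees
    only the second coordinate. Since q = 0 in R, a coefficient [rd (dot x y)] is just [rd y]. *)
Record scalar_cocycle (b0 b1 f0 f1 : H -> H -> R) : Prop := ScalarCocycle {
  sc_b0x0 : forall x, b0 x 0 = 0;
  sc_b1x0 : forall x, b1 x 0 = 0;
  sc_f0x0 : forall x, f0 x 0 = 0;
  sc_f1x0 : forall x, f1 x 0 = 0;
  sc_f00x : forall x, f0 0 x = 0;
  sc_f10x : forall x, f1 0 x = 0;
  sc_b0C : forall x y, b0 x y = b0 y x;
  sc_b1C : forall x y, b1 x y = b1 y x;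
  sc_b0A : forall x y z, b0 y z - b0 (x + y) z + b0 x (y + z) - b0 x y = 0;
  sc_b1A : forall x y z, b1 y z - b1 (x + y) z + b1 x (y + z) - b1 x y = 0;
  sc_f0r : forall x y z, f0 x (y + z) - f0 x y - f0 x z
    = b0 y z + rd x * a * b1 y z - b0 (dot x y) (dot x z);
  sc_f1r : forall x y z, f1 x (y + z) - f1 x y - f1 x z
    = b1 y z - b1 (dot x y) (dot x z);
  sc_f0l : forall x y z, f0 (x + y) z = f0 x z + rd y * a * f1 x z
    + f0 (dot x y) (dot x z) + rd z * b * (f1 x y + b1 x y);
  sc_f1l : forall x y z, f1 (x + y) z = f1 x z + f1 (dot x y) (dot x z) }.

Lemma scalar_cocycle_ext (b0 b1 f0 f1 b0' b1' f0' f1' : H -> H -> R) :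
  b0 =2 b0' -> b1 =2 b1' -> f0 =2 f0' -> f1 =2 f1' ->
  scalar_cocycle b0 b1 f0 f1 -> scalar_cocycle b0' b1' f0' f1'.
Proof.
move=> e0 e1 e2 e3 [h1 h2 h3 h4 h5 h6 h7 h8 h9 h10 h11 h12 h13 h14].
split=> *; rewrite -?e0 -?e1 -?e2 -?e3; do ?[exact: h1 | exact: h2 | exact: h3
 | exact: h4 | exact: h5 | exact: h6]; by [].
Qed.

(** The two sides differ by a multiple of P^2 = 0. *)
Lemma dotA x y z : dot (dot x y) (dot x z) = dot (x + y) z.
Proof.
rewrite /dot; have -> : (1 - P * ((1 - P * x) * y)) * ((1 - P * x) * z) =
  (1 - P * (x + y)) * z + P * P * ((2 - P * x) * x * y * z) by ring.
by rewrite PP mul0r addr0.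
Qed.

Lemma dotDr x y z : dot x (y + z) = dot x y + dot x z.
Proof. exact: mulrDr. Qed.
Lemma dotNr x y : dot x (- y) = - dot x y.
Proof. exact: mulrN. Qed.
Lemma dot0r x : dot x 0 = 0. Proof. exact: mulr0. Qed.
Lemma dot0l x : dot 0 x = x. Proof. by rewrite /dot mulr0 subr0 mul1r. Qed.

Lemma rd_dot x y : rd (dot x y) = rd y.
Proof. by rewrite /dot rmorphM rmorphB rmorphM rmorph_nat qR mul0r subr0 rmorph1 mul1r. Qed.

Lemma scalar_coboundary t s : t 0 = 0 -> s 0 = 0 ->
  scalar_cocycle (fun x y => t x - t (x + y) + t y) (fun x y => s x - s (x + y) + s y)
    (fun x y => t (dot x y) - (t y + rd x * a * s y) - rd y * b * s x)
    (fun x y => s (dot x y) - s y).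
Proof.
move=> t0 s0; split=> [x|x|x|x|x|x|x y|x y|x y z|x y z|x y z|x y z|x y z|x y z];
  rewrite ?dot0r ?dot0l ?dotA ?dotDr ?addr0 ?rd_dot ?rmorph0 ?t0 ?s0 ?addrA ?rmorphD;
  try ring.
- rewrite [y + x]addrC; ring.
- rewrite [y + x]addrC; ring.
Qed.

(** The inverse of multiplication by 1 - P is multiplication by 1 + P, as P^2 = 0. *)
Lemma dot1_bij : bijective (dot 1).
Proof.
exists (dot (- 1)) => x; rewrite /dot.
  have -> : (1 - P * -1) * ((1 - P * 1) * x) = x - P * P * x by ring.
  by rewrite PP mul0r subr0.
have -> : (1 - P * 1) * ((1 - P * -1) * x) = x - P * P * x by ring.
by rewrite PP mul0r subr0.
Qed.

Lemma sum_shift (F : H -> R) y : \sum_x F (x + y) = \sum_x F x.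
Proof.
rewrite (reindex (fun x => x - y)) /=; last first.
  by exists (fun x => x + y) => x _; rewrite ?subrK ?addrK.
by apply: eq_bigr => x _; rewrite subrK.
Qed.

Lemma sum_shiftl (F : H -> R) y : \sum_x F (y + x) = \sum_x F x.
Proof. by rewrite -[RHS](sum_shift F y); apply: eq_bigr => x _; rewrite addrC. Qed.

Lemma sum_dot (F : H -> R) : \sum_x F (dot 1 x) = \sum_x F x.
Proof. by rewrite [RHS](reindex (dot 1)) //=; apply: onW_bij dot1_bij. Qed.

Lemma additive_q0 (F : H -> R) : (forall y z, F (y + z) = F y + F z) -> F P = 0.
Proof.
move=> FD; have F0 : F 0 = 0 by apply: (addrI (F 0)); rewrite -FD !addr0.
have Fn k : F k%:R = F 1 * k%:R.
  by elim: k => [|k IHk]; rewrite ?mulr0 // -[in LHS]natr1 FD IHk -natr1 mulrDr mulr1.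
by rewrite Fn qR mulr0.
Qed.

(** * Linear constraints on gamma, obtained by summing over H *)

Section Constraints.
Hypotheses (cardH : #|H|%:R = 0 :> R) (sum_rd : \sum_x rd x = 0).
Hypothesis sum_mulP : forall F : H -> R, \sum_x F (P * x) = 0.
Hypothesis two_reg : forall k : R, k + k = 0 -> k = 0.
Context (b0 b1 f0 f1 : H -> H -> R) (co : scalar_cocycle b0 b1 f0 f1).

Let sum_const (k : R) : \sum_(x : H) k = 0.
Proof. by rewrite sumr_const -mulr_natr cardH mulr0. Qed.

(** Sum the cocycle identity over its first variable: the constant term is multiplied by |H| = 0,
    and translations preserve sums. *)
Lemma sum_cocycleD y z :
  \sum_x b0 x (y + z) = \sum_x b0 x y + \sum_x b0 x z.
Proof.
have : \sum_x (b0 y z - b0 (x + y) z + b0 x (y + z) - b0 x y) = 0.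
  by apply: big1 => x _; rewrite (sc_b0A co).
rewrite !big_split /= !sumrN sum_const (sum_shift (b0^~ z)) => e.
apply/eqP; rewrite -subr_eq0; apply/eqP; rewrite -[RHS]e; ring.
Qed.

(** Sum [sc_f0r] at x = z = 1 over y. The left side vanishes; on the right S(1) - S(1 - P) stands
    beside the wanted term, where S(z) = sum_x b0(x, z) is additive and so kills P. *)
Lemma a_sum_beta1 : a * \sum_x b1 x 1 = 0.
Proof.
have : \sum_y (f0 1 (y + 1) - f0 1 y - f0 1 1) = 0.
  by rewrite !big_split /= !sumrN sum_const (sum_shift (f0 1)) subrr subr0.
under eq_bigr => y _ do rewrite (sc_f0r co) rmorph1 mul1r.
rewrite !big_split /= !sumrN (sum_dot (b0^~ (dot 1 1))) -mulr_sumr.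
have -> : dot 1 1 = 1 + - P by rewrite /dot !mulr1.
have := additive_q0 sum_cocycleD.
have := sum_cocycleD (1 - P) P; rewrite subrK => -> ->; rewrite addr0 => e.
by rewrite -[RHS]e; ring.
Qed.

Lemma b_sum_beta1 : b * \sum_x b1 x 1 = 0.
Proof.
(* Pair y with - y. *)
have G0 : \sum_y f1 1 y = 0.
  apply: two_reg; apply/eqP; rewrite -oppr_eq0; apply/eqP.
  have : \sum_y (f1 1 (y - y) - f1 1 y - f1 1 (- y)) = 0.
    under eq_bigr => y _ do rewrite (sc_f1r co) dotNr.
    by rewrite big_split /= sumrN (sum_dot (fun y => b1 y (- y))) subrr.
  rewrite !big_split /= !sumrN.
  have -> : \sum_x f1 1 (- x) = \sum_x f1 1 x.
    rewrite (reindex_inj oppr_inj) /=; by apply: eq_bigr => x _; rewrite opprK.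
  under eq_bigr => y _ do rewrite subrr (sc_f1x0 co).
  by rewrite big1 // sub0r opprD.
(* As F is additive it kills P, so that F (1 - P) = F 1; compare the sums over y
   of both sides of the identity [sc_f0l] for f0 (1 + y) 1. *)
pose F z := \sum_x f0 x z.
have FD y z : F (y + z) = F y + F z.
  have : \sum_x (f0 x (y + z) - f0 x y - f0 x z) = 0.
    under eq_bigr => x _ do rewrite (sc_f0r co).
    rewrite !big_split /= !sumrN sum_const -!mulr_suml sum_rd !mul0r.
    (* [dot x y] and [dot x z] depend on x only through P x. *)
    by rewrite (sum_mulP (fun k => b0 ((1 - k) * y) ((1 - k) * z))) !addr0 subrr.
  rewrite !big_split /= !sumrN => e.
  by apply/eqP; rewrite -subr_eq0; apply/eqP; rewrite -[RHS]e /F; ring.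
have Fu : F (dot 1 1) = F 1.
  rewrite /dot !mulr1 -[RHS](congr1 F (subrK P 1)) [RHS]FD.
  by rewrite (additive_q0 FD) addr0.
have : \sum_y (f0 (1 + y) 1) = F 1 by rewrite (sum_shiftl (f0^~ 1)).
under eq_bigr => y _ do rewrite (sc_f0l co) rmorph1 mul1r.
rewrite !big_split /= sum_const -!mulr_suml sum_rd !mul0r -mulr_sumr big_split /=.
rewrite G0 (sum_dot (f0^~ (dot 1 1))) -/(F _) Fu.
under eq_bigr => y _ do rewrite (sc_b1C co).
by rewrite !add0r => e; apply: (addrI (F 1)); rewrite e addr0.
Qed.

End Constraints.

Lemma scalar_cocycleD (b0 b1 f0 f1 b0' b1' f0' f1' : H -> H -> R) :
  scalar_cocycle b0 b1 f0 f1 -> scalar_cocycle b0' b1' f0' f1' ->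
  scalar_cocycle (fun x y => b0 x y + b0' x y) (fun x y => b1 x y + b1' x y)
    (fun x y => f0 x y + f0' x y) (fun x y => f1 x y + f1' x y).
Proof.
move=> [h1 h2 h3 h4 h5 h6 h7 h8 h9 h10 h11 h12 h13 h14].
move=> [k1 k2 k3 k4 k5 k6 k7 k8 k9 k10 k11 k12 k13 k14].
split=> [x|x|x|x|x|x|x y|x y|x y z|x y z|x y z|x y z|x y z|x y z].
- by rewrite h1 k1 addr0.
- by rewrite h2 k2 addr0.
- by rewrite h3 k3 addr0.
- by rewrite h4 k4 addr0.
- by rewrite h5 k5 addr0.
- by rewrite h6 k6 addr0.
- by rewrite h7 k7.
- by rewrite h8 k8.
- by transitivity (0 + 0 : R); [rewrite -{1}(h9 x y z) -(k9 x y z); ring | rewrite addr0].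
- by transitivity (0 + 0 : R); [rewrite -{1}(h10 x y z) -(k10 x y z); ring | rewrite addr0].
- transitivity ((f0 x (y + z) - f0 x y - f0 x z) + (f0' x (y + z) - f0' x y - f0' x z)).
    by ring.
  by rewrite h11 k11; ring.
- transitivity ((f1 x (y + z) - f1 x y - f1 x z) + (f1' x (y + z) - f1' x y - f1' x z)).
    by ring.
  by rewrite h12 k12; ring.
- by rewrite h13 k13; ring.
- by rewrite h14 k14; ring.
Qed.

(* The factor hf is 1/2: the second summand is the binomial coefficient (x choose 2). *)
Lemma bilinear_cocycle (hf w0 w1 : R) : hf + hf = 1 ->
  scalar_cocycle (fun _ _ => 0) (fun _ _ => 0)
    (fun x y => rd y * (rd x * w0 + hf * rd x * (rd x - 1) * (a + b) * w1))
    (fun x y => rd y * (rd x * w1)).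
Proof.
move=> hf2; split=> [x|x|x|x|x|x|x y|x y|x y z|x y z|x y z|x y z|x y z|x y z];
  rewrite ?rmorphD ?rd_dot ?rmorph0; try ring.
have e : a + b = (hf + hf) * (a + b) by rewrite hf2 mul1r.
transitivity (rd z * (rd x * w0 + hf * rd x * (rd x - 1) * (a + b) * w1)
  + rd z * (rd y * w0 + hf * rd y * (rd y - 1) * (a + b) * w1)
  + rd x * rd y * rd z * ((hf + hf) * (a + b)) * w1); first by ring.
rewrite -e; ring.
Qed.

End ScalarCocycles.

(** * Residues and carries *)

Section Reduction.
Context (m n : nat) (m_gt1 : (1 < m)%N) (n_gt1 : (1 < n)%N) (dvd_mn : (m %| n)%N).

(** Reduction Z/n -> Z/m, read off on representatives, just as [diamond] and [prec] read an element
    of H as an exponent or a multiple. It is a ring morphism because m divides n. *)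
Definition red (x : 'Z_n) : 'Z_m := (x : nat)%:R.

Lemma modn_natr k : (k %% n)%:R = k%:R :> 'Z_m.
Proof. by rewrite -[LHS](Zp_nat_mod m_gt1) modn_dvdm // (Zp_nat_mod m_gt1). Qed.

Lemma red_nat k : red k%:R = k%:R.
Proof. by rewrite /red val_Zp_nat // modn_natr. Qed.

Lemma red_zmod_morphism : zmod_morphism red.
Proof.
move=> x y; apply/eqP; rewrite eq_sym subr_eq -[x - y]natr_Zp -[y]natr_Zp !red_nat -natrD.
by rewrite -red_nat natrD !natr_Zp subrK.
Qed.

Lemma red_monoid_morphism : monoid_morphism red.
Proof.
split=> [|x y]; first exact: red_nat 1.
by rewrite -[x]natr_Zp -[y]natr_Zp -natrM !red_nat natrM.
Qed.

Definition redm : {rmorphism 'Z_n -> 'Z_m} :=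
  HB.pack red (GRing.isZmodMorphism.Build _ _ red red_zmod_morphism)
    (GRing.isMonoidMorphism.Build _ _ red red_monoid_morphism).

End Reduction.

(** The summand has period l, and the range consists of k periods with k = 0 in R. *)
Lemma sum_scale_periodic n k l (R : comNzRingType) (F : 'Z_n -> R) :
   (1 < n)%N -> n = (k * l)%N -> k%:R = 0 :> R -> \sum_(x : 'Z_n) F (k%:R * x) = 0.
Proof.
move=> n_gt1 def_n k0.
have -> : \sum_(x : 'Z_n) F (k%:R * x) = \sum_(0 <= i < n) F (k%:R * i%:R).
  have -> : index_iota 0 n = index_iota 0 (Zp_trunc n).+2 by rewrite Zp_cast.
  rewrite big_mkord; by apply: eq_bigr => i _; rewrite natr_Zp.
have kl0 : k%:R * l%:R = 0 :> 'Z_n by rewrite -natrM -def_n -(Zp_nat_mod n_gt1) modnn.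
have -> : index_iota 0 n = index_iota 0 (k * l) by rewrite -def_n.
have step j : \sum_(0 <= i < j * l) F (k%:R * i%:R) = (\sum_(0 <= i < l) F (k%:R * i%:R)) * j%:R.
  elim: j => [|j IHj]; first by rewrite mul0n big_geq // mulr0.
  rewrite mulSn addnC (@big_cat_nat _ _ _ (j * l)%N) ?leq_addr //= IHj -natr1 mulrDr mulr1.
  congr (_ + _); rewrite -{1}[(j * l)%N]add0n big_addn addKn.
  by apply: eq_bigr => i _; rewrite natrD natrM mulrDr [k%:R * (_ * _)]mulrCA kl0 mulr0 addr0.
by rewrite step k0 mulr0.
Qed.

(** * Carries in Z/n and the integral carry cocycle *)

Section Carry.
Context (n q : nat) (n_gt1 : (1 < n)%N).
Local Notation H := 'Z_n.
Local Notation P := (q%:R : H).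
Hypothesis PP : P * P = 0.
Local Notation dot := (@dot H q).
Implicit Types x y z : H.

Definition carry x y : bool := (n <= x + y)%N.
Local Notation rep x := (Posz (nat_of_ord x)).

Lemma ltn_Z x : (x < n)%N.
Proof. by rewrite -[X in (_ < X)%N](Zp_cast n_gt1). Qed.

Lemma repD x y : rep (x + y)%R = rep x + rep y - (carry x y)%:Z * n%:Z.
Proof.
have -> : (x + y)%R = ((x + y)%N)%:R by rewrite natrD !natr_Zp.
rewrite val_Zp_nat // /carry.
have := ltn_Z x; have := ltn_Z y; case: (leqP n (x + y)) => h hx hy.
  have -> : ((x + y) %% n = x + y - n)%N.
    by have := modnDr (x + y - n) n; rewrite subnK // => ->; rewrite modn_small //; lia.
  by rewrite -subzn // PoszD mul1r.
by rewrite modn_small // PoszD mul0r subr0.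
Qed.

Lemma rep_natr x : (rep x)%:~R = x :> H.
Proof. exact: natr_Zp. Qed.

Lemma dvd_intr (k : int) : k%:~R = 0 :> H -> (n%:Z %| k)%Z.
Proof.
move=> k0; rewrite /dvdz /=.
have : (`|k|%N)%:R = 0 :> H.
  by case: k k0 => // m; rewrite NegzE mulrNz => /eqP; rewrite oppr_eq0 => /eqP.
by move/(congr1 (@nat_of_ord _)); rewrite val_Zp_nat // => /eqP.
Qed.

(* With rep/n as a (rational) primitive of [carry], this is the coboundary of -rep/n
   plus a correction (q/n)(x . x) y that makes it integral. *)
Definition carry_f x y : int :=
  ((rep (dot x y) + q%:Z * rep (dot x x) * rep y - rep y) %/ n%:Z)%Z.

(** The division is exact: modulo n the numerator is -P^2 x^2 y = 0. *)
Lemma carry_fE x y : carry_f x y * n%:Z = rep (dot x y) + q%:Z * rep (dot x x) * rep y - rep y.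
Proof.
rewrite divzK //; apply: dvd_intr.
rewrite intrB intrD !intrM !rep_natr -[q%:~R]/(P) /dot.
have -> : (1 - P * x) * y + P * ((1 - P * x) * x) * y - y = - (P * P) * (x * x * y) by ring.
by rewrite PP oppr0 mul0r.
Qed.

Let n_neq0 : n%:Z != 0 :> int. Proof. by lia. Qed.

Lemma carry_sym x y : carry x y = carry y x.
Proof. by rewrite /carry addnC. Qed.

Lemma carryA x y z :
  (carry y z)%:Z - (carry (x + y)%R z)%:Z + (carry x (y + z)%R)%:Z - (carry x y)%:Z = 0.
Proof.
apply: (mulIf n_neq0); rewrite mul0r.
have c s t : (carry s t)%:Z * n%:Z = rep s + rep t - rep (s + t)%R by rewrite repD; ring.
by rewrite !(mulrBl, mulrDl) !c [(x + (y + z))%R]addrA; ring.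
Qed.

(** Multiplied by n, this is an identity between representatives. The correction in [carry_f] costs
    only a multiple of q, which vanishes in R. *)
Lemma carry_fr x y z : carry_f x (y + z)%R - carry_f x y - carry_f x z =
  (carry y z)%:Z - (carry (dot x y) (dot x z))%:Z - q%:Z * (rep (dot x x) * (carry y z)%:Z).
Proof.
apply: (mulIf n_neq0); rewrite !mulrBl !carry_fE dotDr !repD; ring.
Qed.

(** The uncorrected terms telescope by [dotA], so the defect is q/n times that of the correction (x
    . x) z. *)
Lemma carry_fl x y z : (q%:Z %| carry_f (x + y)%R z - carry_f x z - carry_f (dot x y) (dot x z))%Z.
Proof.
(* Modulo n the terms of order 0 and 1 in P cancel, which is the purpose of the factor x . x, and a
   multiple of P^2 is left. *)
have [k def_k] : exists k, rep (dot (x + y) (x + y)) * rep z - rep (dot x x) * rep z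
   - rep (dot (dot x y) (dot x y)) * rep (dot x z) = k * n%:Z.
  apply/dvdzP; apply: dvd_intr; rewrite !intrB !intrM !rep_natr /dot.
  transitivity (P * P * (y * z * (3 * P * x * x * y - x * x - 3 * x * y
    - P * P * x * x * x * y))); first by ring.
  by rewrite PP mul0r.
apply/dvdzP; exists k; apply: (mulIf n_neq0).
rewrite !mulrBl !carry_fE.
rewrite (dotA PP).
rewrite [RHS]mulrAC -def_k; ring.
Qed.

Lemma carry_f0r x : carry_f x 0 = 0.
Proof. by apply: (mulIf n_neq0); rewrite carry_fE dot0r /= mulr0 addr0 subr0 mul0r. Qed.

Lemma carry_f0l x : carry_f 0 x = 0.
Proof.
by apply: (mulIf n_neq0); rewrite carry_fE !dot0l /= mulr0 mul0r addr0 subrr mul0r.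
Qed.

Lemma carry0r x : carry x 0 = false.
Proof. by rewrite /carry addn0 leqNgt ltn_Z. Qed.

(** A gamma = gamma and B gamma = 0 remove the terms in a and b; the remaining integer identities
    hold up to multiples of q, hence exactly in R. *)
Lemma carry_scalar_cocycle (R : comNzRingType) (rd : {rmorphism H -> R}) (a b g0 g1 : R) :
    q%:R = 0 :> R -> a * g1 = 0 -> b * g1 = 0 ->
  scalar_cocycle q rd a b
    (fun x y => (carry x y : nat)%:R * g0) (fun x y => (carry x y : nat)%:R * g1)
    (fun x y => (carry_f x y)%:~R * g0) (fun x y => (carry_f x y)%:~R * g1).
Proof.
move=> qR ag bg.
have ag' (k l : R) : k * a * (l * g1) = 0.
  by rewrite -mulrA [a * _]mulrCA ag !mulr0.
have bg' (k l m : R) : k * b * (l * g1 + m * g1) = 0.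
  by rewrite -mulrA -mulrDl [b * _]mulrCA bg !mulr0.
pose e x y : R := (carry x y : nat)%:R; pose g x y : R := (carry_f x y)%:~R.
have eA x y z : e y z - e (x + y) z + e x (y + z) - e x y = 0.
  by have /(congr1 (fun k : int => k%:~R : R)) := carryA x y z; rewrite !(rmorphB, rmorphD).
have gr x y z : g x (y + z) - g x y - g x z = e y z - e (dot x y) (dot x z).
  have /(congr1 (fun k : int => k%:~R : R)) := carry_fr x y z.
  by rewrite !rmorphB rmorphM /= -[q%:~R]/(q%:R) qR mul0r subr0.
have gl x y z : g (x + y) z = g x z + g (dot x y) (dot x z).
  have /dvdzP[k /(congr1 (fun k : int => k%:~R : R))] := carry_fl x y z.
  rewrite !rmorphB rmorphM /= -[q%:~R]/(q%:R) qR mulr0 => k0.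
  by apply/eqP; rewrite -subr_eq0 opprD addrA; apply/eqP.
rewrite -/e; split=> [x|x|x|x|x|x|x y|x y|x y z|x y z|x y z|x y z|x y z|x y z];
  rewrite ?ag' ?bg' ?addr0 ?carry0r ?carry_f0r ?carry_f0l ?mul0r // -/(g _ _) -/(e _ _).
- by rewrite carry_sym.
- by rewrite carry_sym.
- by rewrite -/(e _ _) -!(mulrBl, mulrDl) eA mul0r.
- by rewrite -/(e _ _) -!(mulrBl, mulrDl) eA mul0r.
- by rewrite -/(e _ _) -!(mulrBl, mulrDl) gr.
- by rewrite -/(e _ _) -!(mulrBl, mulrDl) gr.
- by rewrite -!(mulrBl, mulrDl) gl.
- by rewrite -!(mulrBl, mulrDl) gl.
Qed.

End Carry.

(** * Normal form of a cocycle *)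

Section ColumnVectors.
Context (S : nmodType).

Lemma cV2P (u v : 'cV[S]_2) : u 0 0 = v 0 0 /\ u 1 0 = v 1 0 <-> u = v.
Proof.
split=> [[e0 e1]|-> //]; apply/matrixP=> i j; rewrite [j]ord1.
case: i => [[|[|i]] // Hi].
  by rewrite (_ : Ordinal Hi = 0) //; apply: val_inj.
by rewrite (_ : Ordinal Hi = 1) //; apply: val_inj.
Qed.

Lemma colvec20 (k l : S) : colvec2 k l 0 0 = k. Proof. by rewrite mxE. Qed.
Lemma colvec21 (k l : S) : colvec2 k l 1 0 = l. Proof. by rewrite mxE. Qed.

End ColumnVectors.

Section Cocycles.
Context (p nu eta r : nat).
Hypotheses (p_pr : prime p) (p_odd : odd p) (nu_gt0 : (0 < nu)%N).
Hypotheses (le_nu_eta : (nu <= eta)%N) (le_eta_2nu : (eta <= 2 * nu)%N).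
Hypotheses (r_gt0 : (1 <= r)%N) (le_r_nu : (r <= nu)%N).
Context (a b : 'Z_(p ^ r)).

Local Notation H := 'Z_(p ^ eta).
Local Notation R := 'Z_(p ^ r).
Local Notation I := 'cV[R]_2.
Local Notation A := (mx2 1 a 0 1 : 'M[R]_2).
Local Notation B := (mx2 0 b 0 0 : 'M[R]_2).
Local Notation P := ((p ^ nu)%:R : H).
Local Notation "x ⋅ y" := (@ldot p nu eta x y) (at level 39).
Local Notation "h ⋄ y" := (diamond A h y) (at level 38, right associativity).
Local Notation "y ≺ h" := (prec B y h) (at level 45).
Local Notation cochain := (cochain p eta r).
Local Notation cocycles := (cocycles nu eta A B).
Local Notation coboundaries := (coboundaries nu eta A B).
Implicit Types (x y z h : H) (u v w gamma : I) (c d : cochain).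

Let R_gt1 : (1 < p ^ r)%N.
Proof. by rewrite -{1}(expn0 p) ltn_exp2l ?prime_gt1. Qed.

Let H_gt1 : (1 < p ^ eta)%N.
Proof. by rewrite -{1}(expn0 p) ltn_exp2l ?prime_gt1 //; lia. Qed.

Let dvd_RH : (p ^ r %| p ^ eta)%N.
Proof. by rewrite dvdn_exp2l //; lia. Qed.

Local Notation rd := (redm R_gt1 H_gt1 dvd_RH).

Let natR0 k : (r <= k)%N -> (p ^ k)%:R = 0 :> R.
Proof.
move=> le_rk; rewrite -(Zp_nat_mod R_gt1); have /eqP -> // := dvdn_exp2l p le_rk.
Qed.

Let natH0 k : (eta <= k)%N -> (p ^ k)%:R = 0 :> H.
Proof.
move=> le_k; rewrite -(Zp_nat_mod H_gt1); have /eqP -> // := dvdn_exp2l p le_k.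
Qed.

Let PP : P * P = 0.
Proof. by rewrite -natrM -expnD natH0 //; lia. Qed.

Let PR : (p ^ nu)%:R = 0 :> R.
Proof. exact: natR0. Qed.

Let half : exists hf : R, hf + hf = 1.
Proof.
exists ((p ^ r).+1./2)%:R; rewrite -natrD addnn.
have -> : ((p ^ r).+1./2.*2 = p ^ r + 1)%N.
  by have := odd_double_half (p ^ r).+1; rewrite /= oddX p_odd orbT /= addn1.
by rewrite natrD natR0 // add0r.
Qed.

Let two_reg (k : R) : k + k = 0 -> k = 0.
Proof.
by have [hf e] := half; move=> k0; rewrite -[k]mulr1 -e mulrDr -mulrDl k0 mul0r.
Qed.

Let rdE x : rd x = (x : nat)%:R. Proof. by []. Qed.

Let rd_ldot x y : rd (x ⋅ y) = rd y.
Proof. exact: (rd_dot rd PR). Qed.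

Let A0 u : (A *m u) 0 0 = u 0 0 + a * u 1 0.
Proof.
by rewrite mxE !big_ord_recl big_ord0 !mxE /= mul1r addr0;
  congr (_ + _ * u _ _); apply: val_inj.
Qed.
Let A1 u : (A *m u) 1 0 = u 1 0.
Proof.
by rewrite mxE !big_ord_recl big_ord0 !mxE /= mul1r mul0r addr0 add0r;
  congr (u _ _); apply: val_inj.
Qed.
Let B0 u : (B *m u) 0 0 = b * u 1 0.
Proof.
by rewrite mxE !big_ord_recl big_ord0 !mxE /= mul0r addr0 add0r;
  congr (_ * u _ _); apply: val_inj.
Qed.
Let B1 u : (B *m u) 1 0 = 0.
Proof. by rewrite mxE !big_ord_recl big_ord0 !mxE /= !mul0r !addr0. Qed.

Let AX0 k u : (A ^+ k *m u) 0 0 = u 0 0 + k%:R * a * u 1 0.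
Proof.
elim: k u => [|k IHk] u; first by rewrite expr0 mul1mx !mul0r addr0.
by rewrite exprSr -mulmxA IHk A0 A1 -[in RHS]natr1; ring.
Qed.
Let AX1 k u : (A ^+ k *m u) 1 0 = u 1 0.
Proof. by elim: k u => [|k IHk] u; rewrite ?expr0 ?mul1mx // exprSr -mulmxA IHk A1. Qed.

(** Lets exponents of A be compared through their images in R only. *)
Lemma expA_eq k l u : k%:R = l%:R :> R -> A ^+ k *m u = A ^+ l *m u.
Proof. by move=> e; apply/cV2P; rewrite !AX0 !AX1 e. Qed.

Let D0 h u : (h ⋄ u) 0 0 = u 0 0 + rd h * a * u 1 0. Proof. exact: AX0. Qed.
Let D1 h u : (h ⋄ u) 1 0 = u 1 0. Proof. exact: AX1. Qed.
Let P0 h u : (u ≺ h) 0 0 = rd h * b * u 1 0.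
Proof. by rewrite /prec -scaler_nat mxE B0 mulrA. Qed.
Let P1 h u : (u ≺ h) 1 0 = 0.
Proof. by rewrite /prec -scaler_nat mxE B1 mulr0. Qed.
Let add_mxE u v i j : (u + v) i j = u i j + v i j. Proof. by rewrite mxE. Qed.
Let opp_mxE u i j : (- u) i j = - u i j. Proof. by rewrite mxE. Qed.
Let zero_mxE i j : (0 : I) i j = 0. Proof. by rewrite mxE. Qed.
Let cE := (D0, D1, P0, P1, A0, A1, B0, B1, add_mxE, opp_mxE, zero_mxE).

Lemma prec_eq h h' u : rd h = rd h' -> u ≺ h = u ≺ h'.
Proof. by move=> e; apply/cV2P; rewrite !P0 !P1 e. Qed.

Lemma precDl u v h : (u + v) ≺ h = (u ≺ h) + (v ≺ h).
Proof. by rewrite /prec mulmxDr mulrnDl. Qed.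

Lemma precv0 h : 0 ≺ h = 0.
Proof. by rewrite /prec mulmx0 mul0rn. Qed.

(** The conditions of [is_cocycle] as propositions; the vanishing of beta at (0, x) follows from
    symmetry. *)
Record cocycle (beta f : H -> H -> I) : Prop := Cocycle {
  beta_x0 : forall x, beta x 0 = 0;
  f_x0 : forall x, f x 0 = 0;
  f_0x : forall x, f 0 x = 0;
  beta_sym : forall x y, beta x y = beta y x;
  beta_cocycle : forall x y z,
    beta y z - beta (x + y) z + beta x (y + z) - beta x y = 0;
  f_addr : forall x y z,
    f x (y + z) - f x y - f x z = x ⋄ beta y z - beta (x ⋅ y) (x ⋅ z);
  f_addl : forall x y z,
    f (x + y) z = (x ⋅ y) ⋄ f x z + f (x ⋅ y) (x ⋅ z)
      + (((x ⋅ y) ⋄ f x y) ≺ ((x + y) ⋅ z))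
      + (((x + y) ⋄ beta x y) ≺ ((x + y) ⋅ z)) }.

Lemma cocycle_ext (beta f beta' f' : H -> H -> I) :
  beta =2 beta' -> f =2 f' -> cocycle beta f -> cocycle beta' f'.
Proof.
move=> eb ef [h1 h2 h3 h4 h5 h6 h7].
by split=> *; rewrite -?eb -?ef; [apply: h1 | apply: h2 | apply: h3 | apply: h4
  | apply: h5 | apply: h6 | apply: h7].
Qed.

Definition beta_of c x y : I := c.1 (x, y).
Definition f_of c x y : I := c.2 (x, y).

Lemma cocycleP c : reflect (cocycle (beta_of c) (f_of c)) (c \in cocycles).
Proof.
rewrite inE /beta_of /f_of.
apply: (iffP and4P) => [[/forallP h1 /forallP h2 /forallP h3 /forallP h4]|].
  split=> [x|x|x|x y|x y z|x y z|x y z].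
  - by case/andP: (h1 x) => /eqP.
  - by case/andP: (h2 x) => /eqP.
  - by case/andP: (h2 x) => _ /eqP.
  - exact/eqP/(forallP (h3 x)).
  - by have /and3P[/eqP] := forallP (forallP (h4 x) y) z.
  - by have /and3P[_ /eqP] := forallP (forallP (h4 x) y) z.
  - by have /and3P[_ _ /eqP] := forallP (forallP (h4 x) y) z.
move=> [h1 h2 h2' h3 h4 h5 h6]; split; apply/forallP=> x.
- by rewrite h1 h3 h1 eqxx.
- by rewrite h2 h2' eqxx.
- by apply/forallP=> y; rewrite h3.
- by apply/forallP=> y; apply/forallP=> z; rewrite h4 h5 -h6 !eqxx.
Qed.

Let add4_mxE u v w w' i k l l' : u i 0 = k -> w i 0 = l -> w' i 0 = l' ->
  (u + v + w + w') i 0 = k + v i 0 + l + l'.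
Proof. by rewrite !mxE => -> -> ->. Qed.

Let PD0 h h' u : (h ⋄ u ≺ h') 0 0 = rd h' * b * u 1 0.
Proof. by rewrite P0 D1. Qed.

Let addr_coef u v w w' w'' h : u - v - w = h ⋄ w' - w'' <->
  u 0 0 - v 0 0 - w 0 0 = w' 0 0 + rd h * a * w' 1 0 - w'' 0 0 /\
  u 1 0 - v 1 0 - w 1 0 = w' 1 0 - w'' 1 0.
Proof. by rewrite -cV2P !cE. Qed.

Let addl_coef u v w s g x y z :
  u = (x ⋅ y) ⋄ v + w + (((x ⋅ y) ⋄ s) ≺ ((x + y) ⋅ z))
    + (((x + y) ⋄ g) ≺ ((x + y) ⋅ z)) <->
  u 0 0 = v 0 0 + rd y * a * v 1 0 + w 0 0 + rd z * b * (s 1 0 + g 1 0) /\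
  u 1 0 = v 1 0 + w 1 0.
Proof.
rewrite -cV2P (add4_mxE w (D0 _ _) (PD0 _ _ _) (PD0 _ _ _)).
rewrite (add4_mxE w (D1 _ _) (P1 _ _) (P1 _ _)) !rd_ldot.
by rewrite !addr0 mulrDr !addrA.
Qed.

Let assoc_coef u v w s : u - v + w - s = 0 <->
  u 0 0 - v 0 0 + w 0 0 - s 0 0 = 0 /\ u 1 0 - v 1 0 + w 1 0 - s 1 0 = 0.
Proof. by rewrite -cV2P !cE. Qed.

Let zero_coef u : u = 0 <-> u 0 0 = 0 /\ u 1 0 = 0.
Proof. by rewrite -cV2P !cE. Qed.

Lemma cocycle_coef (beta f : H -> H -> I) : cocycle beta f <->
  @scalar_cocycle H R (p ^ nu) rd a b (fun x y => beta x y 0 0) (fun x y => beta x y 1 0)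
    (fun x y => f x y 0 0) (fun x y => f x y 1 0).
Proof.
split=> [[h1 h2 h3 h4 h5 h6 h7]|[h1 h1' h2 h2' h3 h3' h4 h4' h5 h5' h6 h6' h7 h7']].
  split=> [x|x|x|x|x|x|x y|x y|x y z|x y z|x y z|x y z|x y z|x y z];
  by [case/zero_coef: (h1 x) | case/zero_coef: (h2 x) | case/zero_coef: (h3 x)
     | case/cV2P: (h4 x y) | case/assoc_coef: (h5 x y z)
     | case/addr_coef: (h6 x y z) | case/addl_coef: (h7 x y z)].
split=> [x|x|x|x y|x y z|x y z|x y z].
- by apply/zero_coef.
- by apply/zero_coef.
- by apply/zero_coef.
- by apply/cV2P.
- by apply/assoc_coef.
- by apply/addr_coef; split; [exact: h6 | exact: h6'].
- by apply/addl_coef; split; [exact: h7 | exact: h7'].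
Qed.

Lemma dot1_cancel h : 1 ⋅ ((1 + P) * h) = h.
Proof.
rewrite /ldot (_ : (1 - P * 1) * ((1 + P) * h) = h - P * P * h); last by ring.
by rewrite PP mul0r subr0.
Qed.

(** Together with [dot1_cancel] this identifies [bstar k] as the preimage of 1^{x k} under y -> 1 .
    y. *)
Lemma bstarE k : bstar p nu eta k = (1 + P) * ltimesX p nu eta k.
Proof.
rewrite (ltimesXE p_pr) // /bstar binS bin1 !(natrD, natrM).
rewrite (_ : (1 + P) * _ = k%:R + ('C(k, 2)%:R + k%:R) * P + P * P * 'C(k, 2)%:R); last by ring.
by rewrite PP mul0r addr0.
Qed.

Lemma ltimesX_S k : ltimesX p nu eta k.+1 = 1 + bstar p nu eta k.
Proof. by rewrite bstarE /ltimesX iterS -/(ltimesX p nu eta k) /ltimes; ring. Qed.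

Lemma rd_ltimesX k : rd (ltimesX p nu eta k) = k%:R.
Proof. by rewrite (ltimesXE p_pr) // rmorph_nat natrD natrM natR0 // mulr0 addr0. Qed.

Lemma ldotS k z : (1 + k)%:R ⋅ z = k%:R ⋅ (1 ⋅ z).
Proof.
rewrite /ldot natrD -[1%:R]/(1 : H).
rewrite (_ : (1 - P * k%:R) * ((1 - P * 1) * z) =
  (1 - P * (1 + k%:R)) * z + P * P * (k%:R * z)); last by ring.
by rewrite PP mul0r addr0.
Qed.

(** * A cocycle with beta = alpha_1(gamma) is determined by f(1,1) *)

Section Uniqueness.
Context (beta f : H -> H -> I) (co : cocycle beta f) (gamma : I).
Hypothesis beta_alpha1 : forall x y, beta x y = alpha1 eta gamma (x, y).
Local Notation f0 := (f 1 1).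
Local Notation ftilde := (ftilde nu A f0 gamma).

(** By [f_addr] at x = z = 1, each unit step in y adds f(1,1) and one value of [Gamma]. *)
Let f1_nat k : f 1 k%:R = fhat nu eta A f0 gamma k.
Proof.
rewrite /fhat; elim: k => [|k IHk]; first by rewrite (f_x0 co) mulr0n big_ord0 addr0.
have /eqP := f_addr co 1 k%:R 1.
rewrite !beta_alpha1 {1}/diamond expr1 -addrA -opprD subr_eq natr1 => /eqP->.
by rewrite IHk big_ord_recr /= mulrSr /Gamma (AC (2*(2*1)) ((3*5)*(4*(1*2)))).
Qed.

Let f1E h : f 1 h = ftilde h.
Proof. by rewrite -{1}(natr_Zp h); exact: f1_nat. Qed.

(** A carry would mean [bstar k] = -1, hence 1^{x (k+1)} = 1 + [bstar k] = 0 = 1^{x 0}, against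
    injectivity of the powers below p^eta. *)
Let beta1_bstar k : (k.+1 < p ^ eta)%N -> beta 1 (bstar p nu eta k) = 0.
Proof.
move=> lt_k; rewrite beta_alpha1 ffunE /=; case: leqP => // le_H.
suff : k.+1 = 0%N by [].
apply: (ltimesX_inj p_pr p_odd nu_gt0 le_nu_eta le_eta_2nu) => //; first lia.
rewrite ltimesX_S /ltimesX /=.
have ltb := ltn_Z H_gt1 (bstar p nu eta k).
have e : (bstar p nu eta k).+1 = (p ^ eta)%N.
  by apply/eqP; rewrite eqn_leq ltb; move: le_H; rewrite modn_small.
rewrite -[X in 1 + X]natr_Zp nat1r e natH0 //.
Qed.

(* By [f_addl] at x = 1, f (1 + y) is determined by f (1 . y) and f 1, and
   1 + y is the successor of 1 . y among the powers 1^{x k}. *)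
Lemma f_ltimesX k z : (k < p ^ eta)%N ->
  f (ltimesX p nu eta k) z = frepX nu A B f0 gamma k z.
Proof.
elim: k z => [|k IHk] z lt_k.
  by rewrite (f_0x co) /frepX !big_ord0 precv0 addr0.
have dotb : 1 ⋅ bstar p nu eta k = ltimesX p nu eta k by rewrite bstarE dot1_cancel.
have actE u : ltimesX p nu eta k ⋄ u = A ^+ k *m u.
  by apply: expA_eq; rewrite -rdE rd_ltimesX.
rewrite ltimesX_S (f_addl co) dotb beta1_bstar // !actE.
rewrite (f1E z) (f1E (bstar _ _ _ k)) IHk; last by lia.
(* In [frepX] the new term of the first sum is the one with j = 0, the others being shifted by
   [ldotS]; the new term of the second sum is its last. *)
rewrite /diamond mulmx0 precv0 addr0 /frepX big_ord_recl big_ord_recr /= precDl.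
have -> : (0%:R : H) ⋅ z = z by rewrite /ldot mulr0 subr0 mul1r.
have -> : (k.+1 - 1 - 0 = k)%N by lia.
rewrite -!addrA; congr (_ + _); congr (_ + _).
  apply: eq_bigr => j _; rewrite /bump /=.
  have -> : (k.+1 - 1 - (1 + j) = k - 1 - j)%N by lia.
  by rewrite ldotS.
by congr (_ + _); apply: prec_eq; rewrite !rd_ldot.
Qed.

Lemma f_frep h z : f h z = frep nu eta A B f0 gamma (h, z).
Proof.
have [lt_h {1}<-] := ltimesX_log p_pr p_odd nu_gt0 le_nu_eta le_eta_2nu h.
by rewrite f_ltimesX // ffunE.
Qed.

End Uniqueness.

(** * Realization of every (f0, gamma) with A gamma = gamma and B gamma = 0 *)

Section Model.
Context (f0 gamma : I) (a_gamma : a * gamma 1 0 = 0) (b_gamma : b * gamma 1 0 = 0).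

Let alpha1E x y i : alpha1 eta gamma (x, y) i 0 =
  (carry x y : nat)%:R * gamma i 0.
Proof. by rewrite ffunE /carry /=; case: leqP => _; rewrite ?mul1r // mul0r zero_mxE. Qed.

Lemma model_ex : exists f : H -> H -> I,
  cocycle (fun x y => alpha1 eta gamma (x, y)) f /\ f 1 1 = f0.
Proof.
have [hf hfE] := half.
have Gco := carry_scalar_cocycle H_gt1 PP rd (gamma 0 0) PR a_gamma b_gamma.
pose k : R := (carry_f (p ^ nu) (1 : H) 1)%:~R.
(* At (1,1) the bilinear cocycle takes its two weights as values and the carry cocycle contributes k
   gamma, so these weights make f(1,1) = f0. *)
have Bco := bilinear_cocycle rd a b PR (f0 0 0 - k * gamma 0 0) (f0 1 0 - k * gamma 1 0) hfE.
have co := scalar_cocycleD Bco Gco.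
eexists (fun x y => colvec2 _ _); split.
  apply/cocycle_coef; apply: scalar_cocycle_ext co => x y; last 2 first.
  - by rewrite colvec20.
  - by rewrite colvec21.
  - by rewrite add0r alpha1E.
  - by rewrite add0r alpha1E.
apply/cV2P; rewrite colvec20 colvec21 !(rmorph1 rd) -/k.
by split; ring.
Qed.

Lemma rep_cocycle_in : rep_cocycle nu eta A B (f0, gamma) \in cocycles.
Proof.
have [f [co f11]] := model_ex; apply/cocycleP.
apply: (cocycle_ext _ _ co) => // x y.
by rewrite -f11; exact: (f_frep co (fun _ _ => erefl)).
Qed.

Lemma frep11 : frep nu eta A B f0 gamma (1, 1) = f0.
Proof. by have [f [co f11]] := model_ex; rewrite -{1}f11 -(f_frep co). Qed.

End Model.

Definition cob_beta (tau : H -> I) x y : I := tau x - tau (x + y) + tau y.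
Definition cob_f (tau : H -> I) x y : I :=
  tau (x ⋅ y) - x ⋄ tau y - ((x ⋄ tau x) ≺ (x ⋅ y)).

Let cobf_coef u v w h z :
  (u - h ⋄ v - ((h ⋄ w) ≺ (h ⋅ z))) 0 0 =
  u 0 0 - (v 0 0 + rd h * a * v 1 0) - rd z * b * w 1 0 /\
  (u - h ⋄ v - ((h ⋄ w) ≺ (h ⋅ z))) 1 0 = u 1 0 - v 1 0.
Proof.
have e (t1 t2 : I) (k l : R) i : t1 i 0 = k -> t2 i 0 = l -> (u - t1 - t2) i 0 = u i 0 - k - l.
  by rewrite !mxE => -> ->.
by rewrite (e _ _ _ _ _ (D0 _ _) (PD0 _ _ _)) (e _ _ _ _ _ (D1 _ _) (P1 _ _)) rd_ldot subr0.
Qed.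

Lemma coboundary_cocycle (tau : H -> I) :
  tau 0 = 0 -> cocycle (cob_beta tau) (cob_f tau).
Proof.
move=> t0; apply/cocycle_coef.
have := @scalar_coboundary H R (p ^ nu) rd a b PP PR (fun x => tau x 0 0) (fun x => tau x 1 0).
move=> /(_ _ _)/(scalar_cocycle_ext _ _ _ _); apply; rewrite ?t0 ?zero_mxE // => x y;
  try by rewrite /cob_beta !add_mxE opp_mxE.
- exact/esym/(cobf_coef (tau (x ⋅ y)) (tau y) (tau x) x y).1.
- exact/esym/(cobf_coef (tau (x ⋅ y)) (tau y) (tau x) x y).2.
Qed.

Lemma coboundariesP c : reflect
  (exists tau : H -> I, [/\ tau 0 = 0, beta_of c =2 cob_beta tau & f_of c =2 cob_f tau])
  (c \in coboundaries).
Proof.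
apply: (iffP idP) => [|[tau [t0 h1 h2]]].
  rewrite inE => /andP[_ /existsP[tau /and3P[/eqP t0 /forallP h1 /forallP h2]]].
  exists tau; split=> // x y; [exact/eqP/(forallP (h1 x)) | exact/eqP/(forallP (h2 x))].
rewrite inE; apply/andP; split.
  apply/cocycleP; apply: cocycle_ext (coboundary_cocycle t0) => x y; first by rewrite h1.
  by rewrite h2.
apply/existsP; exists (finfun tau); rewrite ffunE t0 eqxx /=; apply/andP.
split; apply/forallP=> x; apply/forallP=> y; rewrite !ffunE; apply/eqP; [exact: h1 | exact: h2].
Qed.

Lemma beta_ofM c d x y : beta_of (c * d)%g x y = beta_of c x y + beta_of d x y.
Proof. by rewrite /beta_of ffunE. Qed.
Lemma f_ofM c d x y : f_of (c * d)%g x y = f_of c x y + f_of d x y.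
Proof. by rewrite /f_of ffunE. Qed.
Lemma beta_ofV c x y : beta_of c^-1%g x y = - beta_of c x y.
Proof. by rewrite /beta_of ffunE. Qed.
Lemma f_ofV c x y : f_of c^-1%g x y = - f_of c x y.
Proof. by rewrite /f_of ffunE. Qed.

(** * The invariants gamma and f0 of a cocycle *)

Definition class_gamma c : I := \sum_(x : H) beta_of c x 1.
(** The choice of tau, vanishing at 0, and at 1 for a cocycle, whose coboundary agrees with beta(x,
    1) at every x other than -1. *)
Definition class_tau c x : I := - \sum_(i < x) beta_of c i%:R 1.
(** Since [class_tau] vanishes at 1 for a cocycle, its coboundary has [class_tau c (1 ⋅ 1)] as the
    f-value at (1,1). *)
Definition class_f0 c : I := f_of c 1 1 - class_tau c (1 ⋅ 1).

Lemma class_gamma_coef c i : class_gamma c i 0 = \sum_(x : H) beta_of c x 1 i 0.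
Proof. by rewrite /class_gamma summxE. Qed.

Let sum_scaleP (F : H -> R) : \sum_x F (P * x) = 0.
Proof.
by apply: (@sum_scale_periodic _ _ (p ^ (eta - nu))) => //; rewrite -expnD subnKC.
Qed.

Let cardH : #|H|%:R = 0 :> R.
Proof. by rewrite card_ord (Zp_cast H_gt1) natR0 //; lia. Qed.

Let sum_rd : \sum_(x : H) rd x = 0.
Proof.
apply: two_reg; rewrite {2}(reindex_inj oppr_inj) -big_split big1 // => x _.
by rewrite /= -[X in X + _]/(rd x) -[X in _ + X]/(rd (- x)) rmorphN subrr.
Qed.

Lemma class_gammaP c : c \in cocycles ->
  a * class_gamma c 1 0 = 0 /\ b * class_gamma c 1 0 = 0.
Proof.
move=> /cocycleP/cocycle_coef co; rewrite class_gamma_coef; split.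
  exact: (a_sum_beta1 PP PR cardH co).
exact: (b_sum_beta1 PP PR cardH sum_rd sum_scaleP two_reg co).
Qed.

Lemma class_gammaM c d : class_gamma (c * d)%g = class_gamma c + class_gamma d.
Proof. by rewrite -big_split; apply: eq_bigr => x _; exact: beta_ofM. Qed.

Lemma class_gammaV c : class_gamma c^-1%g = - class_gamma c.
Proof. by rewrite -sumrN; apply: eq_bigr => x _; exact: beta_ofV. Qed.

Lemma class_f0M c d : class_f0 (c * d)%g = class_f0 c + class_f0 d.
Proof.
rewrite /class_f0 /class_tau f_ofM.
under eq_bigr => i _ do rewrite beta_ofM.
by rewrite big_split !opprK addrACA.
Qed.

Lemma class_f0V c : class_f0 c^-1%g = - class_f0 c.
Proof.
rewrite /class_f0 /class_tau f_ofV.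
under eq_bigr => i _ do rewrite beta_ofV.
by rewrite sumrN !opprK opprD.
Qed.

Let val_1 : (1 : H) = 1%N :> nat. Proof. by rewrite /= modn_small. Qed.

Lemma carry_1 x : carry x 1 = (x == -1).
Proof.
have := repD H_gt1 x 1; have := ltn_Z H_gt1 x; rewrite val_1 => lt_x e.
apply/idP/eqP => [c1 | x1].
  have h := c1; rewrite /carry val_1 in h.
  suff /val_inj e' : (x + 1)%R = (0 : H) :> nat by apply/eqP; rewrite -addr_eq0 e'.
  have ex : (x + 1 = p ^ eta)%N by apply/eqP; rewrite eqn_leq h addn1 lt_x.
  by apply/eqP; rewrite -eqz_nat e c1 -PoszD ex mul1r subrr.
by move: e; rewrite {1}x1 addNr; case: carry => //; rewrite mul0r subr0 -PoszD addn1 => -[].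
Qed.

Lemma val_addr1 x : x != -1 -> (x + 1)%R = x.+1 :> nat.
Proof.
rewrite -carry_1 => /negPf x1; have := repD H_gt1 x 1.
by rewrite x1 val_1 mul0r subr0 -PoszD addn1 => -[].
Qed.

Lemma alpha1_1 gamma x : alpha1 eta gamma (x, 1) = if x == -1 then gamma else 0.
Proof. by rewrite -carry_1 ffunE. Qed.

Lemma class_rep f0 gamma : a * gamma 1 0 = 0 -> b * gamma 1 0 = 0 ->
  class_f0 (rep_cocycle nu eta A B (f0, gamma)) = f0 /\
  class_gamma (rep_cocycle nu eta A B (f0, gamma)) = gamma.
Proof.
move=> ag bg; split; last first.
  rewrite /class_gamma /beta_of (bigD1 (-1 : H)) //= alpha1_1 eqxx big1 ?addr0 // => x.
  by rewrite alpha1_1 => /negPf->.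
rewrite /class_f0 /f_of [X in X - _](frep11 f0 ag bg).
(* Each index satisfies i + 1 < p^eta, so i is not -1 and alpha_1(gamma) vanishes at (i, 1). *)
rewrite /class_tau big1 ?oppr0 ?addr0 // => i _.
rewrite /beta_of alpha1_1; case: eqP => // e.
have lt_i : (i.+1 < p ^ eta)%N by apply: leq_ltn_trans (ltn_Z H_gt1 (1 ⋅ 1)).
have : (i.+1%:R : H) = 0 by rewrite -natr1 e addNr.
by move/(congr1 (@nat_of_ord _)); rewrite val_Zp_nat // modn_small.
Qed.

(** p^eta and p^nu kill I, so the condition reduces to A gamma = gamma. *)
Lemma admissible_killed f0 gamma : a * gamma 1 0 = 0 -> admissible nu eta A f0 gamma.
Proof.
move=> ag; have killI k u : (p ^ k)%:R = 0 :> R -> u *+ p ^ k = 0.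
  by move=> k0; rewrite -scaler_nat k0 scale0r.
rewrite /admissible mulrnDr mulrnBr ?leq_pexp2l ?prime_gt0 // !killI ?natR0 //; try lia.
by rewrite subrr add0r; apply/esym/eqP; rewrite subr_eq0; apply/eqP/cV2P; rewrite A0 A1 ag addr0.
Qed.

(** The cocycle identity at z = 1 is a recursion on the second argument, which starts at 0 and uses
    only the values at (x, 1). *)
Lemma beta_ext (be be' : H -> H -> I) :
    (forall x y z, be y z - be (x + y) z + be x (y + z) - be x y = 0) ->
    (forall x y z, be' y z - be' (x + y) z + be' x (y + z) - be' x y = 0) ->
    (forall x, be x 0 = be' x 0) -> (forall x, be x 1 = be' x 1) ->
  be =2 be'.
Proof.
have step (f : H -> H -> I) x y :
    (forall x y z, f y z - f (x + y) z + f x (y + z) - f x y = 0) ->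
  f x (y + 1) = f x y - (f y 1 - f (x + y) 1).
  by move=> /(_ x y 1)/eqP; rewrite subr_eq0 addrC => /eqP<-; rewrite addrK.
move=> h h' e0 e1 x y; rewrite -[y]natr_Zp.
elim: (y : nat) x => [|k IHk] x; first exact: e0.
by rewrite -natr1 !step // IHk !e1.
Qed.

Lemma class_tau0 c : class_tau c 0 = 0.
Proof. by rewrite /class_tau big_ord0 oppr0. Qed.

Let assocD u1 u2 u3 u4 v1 v2 v3 v4 :
  u1 - u2 + u3 - u4 = 0 -> v1 - v2 + v3 - v4 = 0 ->
  (u1 + v1) - (u2 + v2) + (u3 + v3) - (u4 + v4) = 0 :> I.
Proof.
move=> e e'; transitivity ((u1 - u2 + u3 - u4) + (v1 - v2 + v3 - v4)).
  by rewrite !opprD (addrACA u1) (addrACA (u1 - u2)) (addrACA (u1 - u2 + u3)).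
by rewrite e e' addr0.
Qed.

Lemma beta_alpha1 c : c \in cocycles ->
  beta_of c =2 fun x y => cob_beta (class_tau c) x y + alpha1 eta (class_gamma c) (x, y).
Proof.
move=> cc; have [ag bg] := class_gammaP cc.
have /cocycleP[h0 _ _ hC hA _ _] := cc.
(* This supplies the identities of alpha_1(gamma); the value 0 of f0 is an arbitrary choice. *)
have /cocycleP[k0 _ _ _ kA _ _] := rep_cocycle_in 0 ag bg.
have [l0 _ _ _ lA _ _] := coboundary_cocycle (class_tau0 c).
apply: beta_ext => [//|x y z|x|x].
- exact: assocD (lA x y z) (kA x y z).
- by rewrite h0 l0 -/(beta_of (rep_cocycle nu eta A B (0, class_gamma c)) x 0) k0 addr0.
have tau1 : class_tau c 1 = 0.
  by rewrite /class_tau val_1 big_ord_recl big_ord0 addr0 hC h0 oppr0.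
(* For x other than -1, consecutive partial sums differ by beta(x, 1); at x = -1 the sum wraps
   around and the deficit is gamma. *)
rewrite alpha1_1 /cob_beta tau1 addr0; case: (altP eqP) => [x1 | /val_addr1 e].
  rewrite x1 addNr class_tau0 subr0 /class_gamma /class_tau -x1.
  have -> : \sum_y beta_of c y 1 = \sum_(i < x.+1) beta_of c i%:R 1.
    have -> : \sum_y beta_of c y 1 = \sum_(0 <= i < p ^ eta) beta_of c i%:R 1.
      have -> : index_iota 0 (p ^ eta) = index_iota 0 (Zp_trunc (p ^ eta)).+2.
        by rewrite Zp_cast.
      by rewrite big_mkord; apply: eq_bigr => i _; rewrite natr_Zp.
    rewrite -(big_mkord xpredT (fun i => beta_of c i%:R 1)); congr (\sum_(_ <- index_iota _ _) _).
    have := carry_1 x; rewrite x1 eqxx /carry val_1 addn1 => h.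
    by apply/eqP; rewrite eqn_leq h ltn_Z.
  by rewrite big_ord_recr /= natr_Zp addKr.
by rewrite addr0 /class_tau e big_ord_recr /= natr_Zp opprK addKr.
Qed.

(** Dividing c by the coboundary d of [class_tau c] leaves beta = alpha_1(gamma) and f(1,1) = f0; by
    uniqueness the quotient is the representative. *)
Lemma rep_cocycle_coboundary c : c \in cocycles ->
  (c * (rep_cocycle nu eta A B (class_f0 c, class_gamma c))^-1)%g \in coboundaries.
Proof.
move=> cc; have [ag bg] := class_gammaP cc.
pose tau := class_tau c; apply/coboundariesP; exists tau; split=> [|x y|x y].
- exact: class_tau0.
- by rewrite beta_ofM beta_ofV beta_alpha1 // addrK.
pose d : cochain := ([ffun xy => cob_beta tau xy.1 xy.2], [ffun xy => cob_f tau xy.1 xy.2]).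
have db : beta_of d =2 cob_beta tau by move=> u v; rewrite /beta_of ffunE.
have df : f_of d =2 cob_f tau by move=> u v; rewrite /f_of ffunE.
have dc : d \in coboundaries.
  by apply/coboundariesP; exists tau; split=> //; exact: class_tau0.
have dz : d \in cocycles by move: dc; rewrite inE => /andP[].
have cd : (c * d^-1)%g \in cocycles.
  by rewrite (@groupM _ (cocycles_group _ _ _ _)) // groupV.
have cdb s t : beta_of (c * d^-1)%g s t = alpha1 eta (class_gamma c) (s, t).
  by rewrite beta_ofM beta_ofV beta_alpha1 // db addrAC subrr add0r.
have f11 : f_of (c * d^-1)%g 1 1 = class_f0 c.
  rewrite f_ofM f_ofV df /cob_f /class_f0 -/tau.
  have -> : tau 1 = 0.
    have /cocycleP[h0 _ _ hC _ _ _] := cc.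
    by rewrite /tau /class_tau val_1 big_ord_recl big_ord0 addr0 hC h0 oppr0.
  by rewrite /diamond mulmx0 precv0 !subr0.
have e : f_of (c * d^-1)%g x y = frep nu eta A B (class_f0 c) (class_gamma c) (x, y).
  exact: etrans (f_frep (elimT (cocycleP _) cd) cdb x y)
    (congr1 (fun u : I => frep nu eta A B u _ (x, y)) f11).
rewrite f_ofM f_ofV [X in _ - X]/(f_of _ x y) /= -[X in _ - X]e.
by rewrite f_ofM f_ofV df opprB addrC subrK.
Qed.

Let addl_mxE u v i k : u i 0 = k -> (u + v) i 0 = k + v i 0.
Proof. by rewrite mxE => ->. Qed.

Lemma class_coboundary c : c \in cocycles -> reflect
  (class_gamma c = 0 /\ exists w : R, class_f0 c = colvec2 ((a + b) * w) 0)
  (c \in coboundaries).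
Proof.
move=> cc; apply: (iffP idP) => [/coboundariesP[tau [t0 hb hf]]|[g0 [w hw]]].
  split.
    rewrite /class_gamma; under eq_bigr => x _ do rewrite hb.
    rewrite /cob_beta !big_split /= sumrN sumr_const -scaler_nat cardH scale0r addr0.
    rewrite (reindex_inj (addIr 1)) /= subrr //.
  (* The partial sums telescope, and 1 . 1 reduces to 1 in R, so that f0 = tau(1) - A tau(1) - B
     tau(1), whose coordinates are -(a + b) tau(1)_1 and 0. *)
  exists (- tau 1 1 0).
  have tele k : \sum_(i < k) beta_of c i%:R 1 = - tau k%:R + k%:R *: tau 1.
    elim: k => [|k IHk]; first by rewrite big_ord0 t0 oppr0 scale0r addr0.
    rewrite big_ord_recr /= IHk hb /cob_beta natr1 -[X in _ = _ + X *: _]natr1 scalerDl scale1r.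
    rewrite [- _ + _]addrC -addrA [- tau k%:R + _]addrA [- tau k%:R + (_ - _)]addrA.
    by rewrite addNr add0r addrCA.
  rewrite /class_f0 /class_tau opprK tele natr_Zp hf.
  have -> : (nat_of_ord (1 ⋅ 1))%:R = 1 :> R by rewrite -rdE rd_ldot (rmorph1 rd).
  rewrite scale1r.
  have [e0 e1] := cobf_coef (tau (1 ⋅ 1)) (tau 1) (tau 1) 1 1.
  apply/cV2P; rewrite /cob_f (addl_mxE _ e0) (addl_mxE _ e1) !add_mxE !opp_mxE.
  rewrite colvec20 colvec21 (rmorph1 rd).
  by split; ring.
suff : rep_cocycle nu eta A B (class_f0 c, class_gamma c) \in coboundaries.
  move=> h; have := rep_cocycle_coboundary cc.
  by rewrite -(@groupMr _ (coboundaries_group _ _ _ _) _ _ h) mulgKV.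
(* This tau is additive, so its beta is zero, while its f(1,1) is ((a + b) w, 0); uniqueness
   identifies its coboundary with the representative. *)
rewrite g0 hw; pose tau x : I := colvec2 0 (- (rd x * w)).
have t0 : tau 0 = 0 by apply/cV2P; rewrite colvec20 colvec21 !zero_mxE (rmorph0 rd) mul0r oppr0.
have bt x y : cob_beta tau x y = 0.
  apply/cV2P; rewrite /cob_beta !add_mxE !opp_mxE !colvec20 !colvec21 !zero_mxE (rmorphD rd).
  by split; ring.
have al x y : alpha1 eta (0 : I) (x, y) = 0 by rewrite ffunE /=; case: ifP.
apply/coboundariesP; exists tau; split=> // x y; first by rewrite bt; exact: al.
have := f_frep (coboundary_cocycle t0) (fun x y => etrans (bt x y) (esym (al x y))) x y.
have -> // : cob_f tau 1 1 = colvec2 ((a + b) * w) 0.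
have [e0 e1] := cobf_coef (tau (1 ⋅ 1)) (tau 1) (tau 1) 1 1.
apply/cV2P; rewrite /cob_f e0 e1 !colvec20 !colvec21 rd_ldot (rmorph1 rd).
by split; ring.
Qed.

End Cocycles.

(** * Classification *)

Section Residues.
Context (p r : nat) (p_pr : prime p) (r_gt0 : (1 <= r)%N).
Local Notation R := 'Z_(p ^ r).
Implicit Types x y : R.

Let R_gt1 : (1 < p ^ r)%N.
Proof. by rewrite -{1}(expn0 p) ltn_exp2l ?prime_gt1. Qed.

Lemma unit_intr (k : int) : ~~ (p %| k)%Z -> (k%:~R : R) \is a GRing.unit.
Proof.
have nat_unit n : ~~ (p %| n)%N -> (n%:R : R) \is a GRing.unit.
  by move=> pn; rewrite unitZpE // coprimeXl // prime_coprime.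
by case: k => n pn; rewrite ?NegzE ?mulrNz ?unitrN; apply: nat_unit.
Qed.

Lemma multZP d x : reflect (exists y, x = y *+ d) (x \in multZ (p ^ r) d).
Proof.
apply: (iffP imsetP) => [[y _ ->]|[y ->]]; first by exists y.
by exists y; rewrite ?inE.
Qed.

Lemma natr_eq0 (n : nat) : (n%:R == 0 :> R) = (p ^ r %| n)%N.
Proof. by rewrite -val_eqE /= val_Zp_nat. Qed.

Lemma mul_unit_intr_eq0 (k : int) e x : ~~ (p %| k)%Z ->
  k%:~R * (p ^ e)%:R * x = 0 <-> (p ^ e)%:R * x = 0.
Proof.
move=> /unit_intr k_unit; rewrite -mulrA; split=> [e0|->]; last by rewrite mulr0.
by apply: (mulrI k_unit); rewrite mulr0.
Qed.

(** Turns the annihilator condition on the second coordinate of gamma into membership in p^(r-t)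
    R. *)
Lemma mulXn_eq0 e x : (e <= r)%N ->
  (p ^ e)%:R * x = 0 <-> x \in multZ (p ^ r) (p ^ (r - e)).
Proof.
move=> le_er; have def_r : (p ^ r = p ^ e * p ^ (r - e))%N by rewrite -expnD subnKC.
split=> [e0|/multZP[y ->]]; last first.
  rewrite -[y *+ _]mulr_natr mulrCA -natrM -def_r (_ : (p ^ r)%:R = 0) ?mulr0 //.
  by apply/eqP; rewrite natr_eq0.
have : (p ^ e)%:R * (x : nat)%:R == 0 :> R by rewrite natr_Zp e0.
rewrite -natrM natr_eq0 {1}def_r dvdn_pmul2l ?expn_gt0 ?prime_gt0 // => /dvdnP[k def_x].
by apply/multZP; exists k%:R; rewrite -mulrnA -def_x natr_Zp.
Qed.

Lemma intr_neq0_lt (k : int) e x : x = k%:~R * (p ^ e)%:R -> x != 0 -> (e < r)%N.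
Proof.
move=> ->; rewrite ltnNge; apply: contra => le_re.
by rewrite (_ : (p ^ e)%:R = 0) ?mulr0 //; apply/eqP; rewrite natr_eq0 dvdn_exp2l.
Qed.

Lemma multZ_unit (k : int) e x : ~~ (p %| k)%Z ->
  (exists w, x = k%:~R * (p ^ e)%:R * w) <-> x \in multZ (p ^ r) (p ^ e).
Proof.
move=> /unit_intr k_unit; split=> [[w ->]|/multZP[y ->]].
  by apply/multZP; exists (k%:~R * w); rewrite -[RHS]mulr_natr mulrAC.
by exists (k%:~R^-1 * y); rewrite mulrACA divrr // mul1r mulr_natl.
Qed.

Lemma natr_multZ_inj e (m n : nat) : (e <= r)%N -> (m < p ^ e)%N -> (n < p ^ e)%N ->
  (m%:R - n%:R : R) \in multZ (p ^ r) (p ^ e) -> m = n.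
Proof.
move=> le_er lt_m lt_n /multZP[y /eqP]; rewrite subr_eq -[y]natr_Zp -mulrnA -natrD => /eqP.
move/(congr1 (@nat_of_ord _)); rewrite !val_Zp_nat // => /(congr1 (modn^~ (p ^ e)%N)).
have dvd_e : (p ^ e %| p ^ r)%N by rewrite dvdn_exp2l.
by rewrite !modn_dvdm // modnMDl !modn_small.
Qed.

End Residues.

Section Classification.
Context (p nu eta r : nat).
Hypotheses (p_pr : prime p) (p_odd : odd p) (nu_gt0 : (0 < nu)%N).
Hypotheses (le_nu_eta : (nu <= eta)%N) (le_eta_2nu : (eta <= 2 * nu)%N).
Hypotheses (r_gt0 : (1 <= r)%N) (le_r_nu : (r <= nu)%N).
Context (a b : 'Z_(p ^ r)) (c1 : int) (c2 t : nat).
Local Notation R := 'Z_(p ^ r).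
Local Notation I := 'cV[R]_2.
Local Notation A := (mx2 1 a 0 1 : 'M[R]_2).
Local Notation B := (mx2 0 b 0 0 : 'M[R]_2).
Local Notation cochain := (cochain p eta r).
Local Notation cocycles := (cocycles nu eta A B).
Local Notation coboundaries := (coboundaries nu eta A B).
Hypothesis c_eq : a + b = c1%:~R * (p ^ c2)%:R.
Hypotheses (c1_p : ~~ (p %| c1)%Z) (le_c2_r : (c2 <= r)%N) (le_t_r : (t <= r)%N).
(** The common annihilator of a and b, that is, the possible second coordinates of gamma. *)
Hypothesis kill_ab : forall x : R,
  (a * x = 0 /\ b * x = 0) <-> x \in multZ (p ^ r) (p ^ (r - t)).

Local Notation M := (multZ (p ^ r) (p ^ c2)).

Let coboundary_class (c : cochain) : c \in cocycles -> c \in coboundaries <->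
  [/\ class_gamma c = 0, class_f0 nu c 0 0 \in M & class_f0 nu c 1 0 = 0].
Proof.
move=> cc; split.
  case/(class_coboundary p_pr p_odd nu_gt0 le_nu_eta le_eta_2nu r_gt0 le_r_nu cc) => -> [w ->].
  split; rewrite // mxE //; apply/(multZ_unit p_pr r_gt0 _ _ c1_p).
  by exists w; rewrite c_eq.
case=> g0 /(multZ_unit p_pr r_gt0 _ _ c1_p)[w hw] h1.
apply/(class_coboundary p_pr p_odd nu_gt0 le_nu_eta le_eta_2nu r_gt0 le_r_nu cc).
split=> //; exists w; apply/cV2P; rewrite colvec20 colvec21 h1 c_eq.
by rewrite hw.
Qed.

(** The homomorphism for the first isomorphism theorem: on cocycles its kernel is the group of
    coboundaries and its image is the claimed group. *)
Definition class_coords (c : cochain) : (coset_of M * R) * (R * R) :=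
  ((coset M (class_f0 nu c 0 0), class_f0 nu c 1 0), (class_gamma c 0 0, class_gamma c 1 0)).

Let normM (x : R) : x \in 'N(M)%g.
Proof.
by rewrite inE; apply/subsetP=> _ /imsetP[y My ->]; rewrite conjgE /= [(y * x)%g]addrC mulKg.
Qed.

Lemma class_coordsM : {in cocycles_group nu eta A B &,
  {morph class_coords : c d / (c * d)%g}}.
Proof.
move=> c d _ _; rewrite /class_coords class_f0M class_gammaM !mxE.
have -> x y : coset M (x + y) = (coset M x * coset M y)%g.
  exact: (morphM (coset_morphism M) (normM x) (normM y)).
by [].
Qed.

Canonical class_coords_morphism := Morphism class_coordsM.

Lemma ker_class_coords : ('ker class_coords)%g = coboundaries.
Proof.
apply/setP=> c; apply/idP/idP => [|cb].
  move=> /[dup] /dom_ker cc /mker [e1 e2 e3 e4]; apply/(coboundary_class cc).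
  split=> //; first by apply/cV2P; rewrite e3 e4 !mxE.
  exact: coset_idr.
have cc : c \in cocycles by move: cb; rewrite inE => /andP[].
have [g0 h0 h1] := (coboundary_class cc).1 cb.
by apply/kerP => //; rewrite /= /class_coords g0 h1 (coset_id h0) !mxE.
Qed.

(** [class_gammaP] bounds the image; the representatives attain every value, by [class_rep]. *)
Lemma im_class_coords : (class_coords @* cocycles_group nu eta A B)%g =
  setX (setX ([set: R] / M)%g [set: R]) (setX [set: R] (multZ (p ^ r) (p ^ (r - t)))).
Proof.
apply/setP=> -[[x y] [z w]]; rewrite !inE /= andbT; apply/morphimP/andP.
  case=> c _ cc [-> _ _ ->]; split; first exact: mem_quotient.
  by apply/kill_ab; apply: class_gammaP cc.
case=> /morphimP[x' _ _ ->] /kill_ab[aw bw].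
have gw : (colvec2 z w) 1 0 = w by rewrite mxE.
rewrite -gw in aw bw.
have qc : rep_cocycle nu eta A B (colvec2 x' y, colvec2 z w) \in cocycles.
  exact: rep_cocycle_in.
exists (rep_cocycle nu eta A B (colvec2 x' y, colvec2 z w)) => //.
have [e1 e2] := class_rep p_pr p_odd nu_gt0 le_nu_eta le_eta_2nu r_gt0 le_r_nu (colvec2 x' y) aw bw.
by rewrite /= /class_coords e1 e2 !mxE.
Qed.

Lemma cohomology2_isog : cohomology2 nu eta A B \isog
  setX (setX ([set: R] / M)%g [set: R]) (setX [set: R] (multZ (p ^ r) (p ^ (r - t)))).
Proof.
rewrite /cohomology2 -ker_class_coords -im_class_coords.
exact: first_isog class_coords_morphism.
Qed.

Lemma cohomology2_parametrization : parametrizes_cohomology2 nu eta A B (fun f0gamma =>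
  exists z1 z2 z3 z4 : nat,
    [/\ (z1 < p ^ c2)%N, (z2 < p ^ r)%N, (z3 < p ^ r)%N & (z4 < p ^ t)%N] /\
    f0gamma = (colvec2 z1%:R z2%:R, colvec2 z3%:R (p ^ (r - t) * z4)%:R)).
Proof.
have good (z3 : R) z4 : a * (colvec2 z3 (p ^ (r - t) * z4)%:R : I) 1 0 = 0 /\
    b * (colvec2 z3 (p ^ (r - t) * z4)%:R : I) 1 0 = 0.
  by rewrite !mxE; apply/kill_ab/multZP; exists z4%:R; rewrite mulnC mulrnA.
have val_lt (x : R) : (x < p ^ r)%N.
  by rewrite -[X in (_ < X)%N](@Zp_cast (p ^ r)) // -{1}(expn0 p) ltn_exp2l ?prime_gt1.
split.
- move=> _ [z1 [z2 [z3 [z4 [_ ->]]]]]; have [aw _] := good z3%:R z4.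
  exact: admissible_killed.
- move=> _ [z1 [z2 [z3 [z4 [_ ->]]]]]; have [aw bw] := good z3%:R z4.
  exact: rep_cocycle_in.
move=> X /morphimP[z Nz cz def_X].
(* X is the coset of z, so membership says that the representative times z^-1 is a coboundary, which
   the invariants decide. *)
have memX (q : I * I) : a * q.2 1 0 = 0 -> b * q.2 1 0 = 0 ->
    rep_cocycle nu eta A B q \in (X : {set cochain}) <->
    [/\ q.2 = class_gamma z, q.1 0 0 - class_f0 nu z 0 0 \in M & q.1 1 0 = class_f0 nu z 1 0].
  case: q => f0 gamma /= aw bw.
  have qc := rep_cocycle_in p_pr p_odd nu_gt0 le_nu_eta le_eta_2nu r_gt0 le_r_nu f0 aw bw.
  have qz : (rep_cocycle nu eta A B (f0, gamma) * z^-1)%g \in cocycles.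
    by rewrite (@groupM _ (cocycles_group _ _ _ _)) // groupV.
  rewrite def_X val_coset // mem_rcoset coboundary_class //.
  rewrite class_gammaM class_f0M class_gammaV class_f0V.
  have [-> ->] := class_rep p_pr p_odd nu_gt0 le_nu_eta le_eta_2nu r_gt0 le_r_nu f0 aw bw.
  have subE (u v : I) i : (u - v) i 0 = u i 0 - v i 0 by rewrite !mxE.
  rewrite !subE; split=> -[e1 e2 e3]; split=> //; try exact: subr0_eq.
    by rewrite e1 subrr.
  by rewrite e3 subrr.
set f := class_f0 nu z in memX; set g := class_gamma z in memX.
have [w def_w] : exists w, g 1 0 = w *+ p ^ (r - t).
  by apply/multZP/kill_ab; exact: class_gammaP cz.
(* Only w modulo p^t matters, since p^t p^(r-t) = 0 in R. *)
have eq_g : colvec2 (g 0 0 : nat)%:R (p ^ (r - t) * (w %% p ^ t))%:R = g.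
  apply/cV2P; rewrite colvec20 colvec21 natr_Zp; split=> //.
  rewrite def_w -[in RHS](natr_Zp w) [in RHS](divn_eq w (p ^ t)) natrD mulrnDl -!mulrnA.
  have -> : (w %/ p ^ t * p ^ t * p ^ (r - t))%:R = 0 :> R.
    by apply/eqP; rewrite natr_eq0 // -mulnA -expnD subnKC // dvdn_mull.
  by rewrite add0r mulnC.
have Mf : (f 0 0 %% p ^ c2)%:R - f 0 0 \in M.
  apply/multZP; exists (- (f 0 0 %/ p ^ c2)%:R).
  rewrite -[X in _ - X]natr_Zp {2}(divn_eq (f 0 0) (p ^ c2)) natrD opprD addrCA subrr addr0.
  by rewrite natrM mulNrn mulr_natr.
exists (colvec2 (f 0 0 %% p ^ c2)%:R (f 1 0 : nat)%:R,
        colvec2 (g 0 0 : nat)%:R (p ^ (r - t) * (w %% p ^ t))%:R); split.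
  split.
    exists (f 0%R 0%R %% p ^ c2)%N, (f 1 0), (g 0 0), (w %% p ^ t)%N.
    by rewrite !val_lt !ltn_pmod ?expn_gt0 ?prime_gt0.
  have [aw bw] := good (g 0 0 : nat)%:R (w %% p ^ t)%N.
  by apply: (memX (_, _) aw bw).2; split=> //; rewrite ?colvec20 // colvec21 natr_Zp.
(* Uniqueness concerns the pair of vectors: [memX] fixes gamma and the second coordinate of f0, and
   z1 is the remainder below p^c2 in a fixed class modulo M. *)
move=> _ [[z1 [z2 [z3 [z4 [[lt1 _ _ _] ->]]]]]].
have [aw bw] := good z3%:R z4; case/memX => //= -> + e3; rewrite eq_g.
rewrite colvec20 => Mz1; congr (_, _); apply/cV2P; rewrite e3 !colvec20 colvec21 natr_Zp.
split=> //; congr _%:R.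
apply: (natr_multZ_inj p_pr r_gt0 le_c2_r) => //; first by rewrite ltn_pmod ?expn_gt0 ?prime_gt0.
have /multZP[y1 e1] := Mf; have /multZP[y2 e2] := Mz1.
by apply/multZP; exists (y1 - y2); rewrite mulrnBl -e1 -e2 opprB addrA subrK.
Qed.

End Classification.

Theorem proposition4p10 (p nu eta r : nat) (p_prime : prime p) (p_odd : odd p)
    (nu_gt0 : (0 < nu)%N) (le_nu_eta : (nu <= eta)%N)
    (le_eta_2nu : (eta <= 2 * nu)%N) (r_gt0 : (1 <= r)%N) (le_r_nu : (r <= nu)%N)
    (a b c : 'Z_(p ^ r)) (c_def : c = a + b)
    (a_neq0 : a != 0) (b_neq0 : b != 0) (c_neq0 : c != 0)
    (a1 b1 c1 : int) (a2 b2 c2 : nat)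
    (a_eq : a = a1%:~R * (p ^ a2)%:R) (b_eq : b = b1%:~R * (p ^ b2)%:R)
    (c_eq : c = c1%:~R * (p ^ c2)%:R)
    (a1_p : ~~ (p %| a1)%Z) (b1_p : ~~ (p %| b1)%Z) (c1_p : ~~ (p %| c1)%Z) :
  let A : 'M['Z_(p ^ r)]_2 := mx2 1 a 0 1 in
  let B : 'M['Z_(p ^ r)]_2 := mx2 0 b 0 0 in
  let t := minn a2 b2 in
  cohomology2 nu eta A B \isog
    setX (setX ([set: 'Z_(p ^ r)] / multZ (p ^ r) (p ^ c2))%g [set: 'Z_(p ^ r)])
         (setX [set: 'Z_(p ^ r)] (multZ (p ^ r) (p ^ (r - t))))
  /\
  parametrizes_cohomology2 nu eta A B (fun f0gamma =>
    exists z1 z2 z3 z4 : nat,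
      [/\ (z1 < p ^ c2)%N, (z2 < p ^ r)%N, (z3 < p ^ r)%N & (z4 < p ^ t)%N] /\
      f0gamma = (colvec2 z1%:R z2%:R, colvec2 z3%:R (p ^ (r - t) * z4)%:R)).
Proof.
move=> A B t.
have lt_a2 := intr_neq0_lt p_prime r_gt0 a_eq a_neq0.
have lt_b2 := intr_neq0_lt p_prime r_gt0 b_eq b_neq0.
have le_c2 := ltnW (intr_neq0_lt p_prime r_gt0 c_eq c_neq0).
have le_t : (t <= r)%N by rewrite geq_min ltnW.
(* The units a1 and b1 drop out, and p^a2 and p^b2 both kill x exactly when the smaller power p^t
   does. *)
have kill x : (a * x = 0 /\ b * x = 0) <-> x \in multZ (p ^ r) (p ^ (r - t)).
  rewrite -(mulXn_eq0 p_prime r_gt0 x le_t) a_eq b_eq.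
  rewrite (mul_unit_intr_eq0 p_prime r_gt0 a2 x a1_p) (mul_unit_intr_eq0 p_prime r_gt0 b2 x b1_p).
  have mono e : (t <= e)%N -> (p ^ t)%:R * x = 0 -> (p ^ e)%:R * x = 0.
    by move=> le_te e0; rewrite -(subnK le_te) expnD natrM -mulrA e0 mulr0.
  split=> [[e1 e2]|e0]; first by rewrite /t /minn; case: ifP.
  by split; apply: mono; rewrite // geq_min leqnn ?orbT.
rewrite c_def in c_eq; split.
  exact: cohomology2_isog c_eq c1_p kill.
exact: cohomology2_parametrization c_eq c1_p le_c2 le_t kill.
Qed.
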